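(* Let $\delta>\delta_{\mathrm{AMP}}:=\frac{64}{\pi^2}-4$, let $\alpha_0\in\mathbb{C}$ with $0<|\alpha_0|\le1$ and let $\sigma_0^2\in[0,1)$. For $\sigma_w^2>0$ let $(\alpha_t,\sigma_t^2)$ be the SE sequences with noise level $\sigma_w^2$, and set $$\mathrm{AMSE}(\sigma_w^2,\delta):=\lim_{t\to\infty}\Big[(1-|\alpha_t|)^2+\sigma_t^2\Big].$$ Then this limit exists for all sufficiently small $\sigma_w^2>0$, and $$\lim_{\sigma_w^2\to0}\frac{\mathrm{AMSE}(\sigma_w^2,\delta)}{\sigma_w^2}=\frac{4}{1-\frac2\delta}.$$
   Context: Complex state evolution (SE). Fix $\delta>0$ and $\sigma_w^2\ge0$. For $\alpha\in\mathbb{C}$ and $\sigma^2\ge0$ with $(\alpha,\sigma^2)\neq(0,0)$, let $\theta_\alpha$ be the argument of $\alpha$ ($\theta_0:=0$) and define $$\psi_1(\alpha,\sigma^2)=e^{\mathrm{i}\theta_\alpha}\int_0^{\pi/2}\frac{|\alpha|\sin^2\theta}{(|\alpha|^2\sin^2\theta+\sigma^2)^{1/2}}\,d\theta,$$ $$\psi_2(\alpha,\sigma^2;\delta,\sigma_w^2)=\frac4\delta\Big(|\alpha|^2+\sigma^2+1-\int_0^{\pi/2}\frac{2|\alpha|^2\sin^2\theta+\sigma^2}{(|\alpha|^2\sin^2\theta+\sigma^2)^{1/2}}\,d\theta\Big)+4\sigma_w^2 .$$ Given $(\alpha_0,\sigma_0^2)$, the SE sequences are defined by $\alpha_{t+1}=\psi_1(\alpha_t,\sigma_t^2)$,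 $\sigma_{t+1}^2=\psi_2(\alpha_t,\sigma_t^2;\delta,\sigma_w^2)$ for $t\ge0$. *)

(* Defs.v *)
From Stdlib Require Import Reals Lra ClassicalEpsilon.
Open Scope R_scope.

Definition Cpx : Type := (R * R)%type.
Definition Cmod (z : Cpx) : R := sqrt (fst z ^ 2 + snd z ^ 2).

(* Riemann integral over [a,b], chosen via classical choice among the values
   of RiemannInt over integrability proofs (unique when integrable). *)
Definition RInt (f : R -> R) (a b : R) : R :=
  epsilon (inhabits 0)
    (fun v => exists pr : Riemann_integrable f a b, RiemannInt pr = v).

Definition I1 (a s2 : R) : R :=
  RInt (fun th => a * (sin th) ^ 2 / sqrt (a ^ 2 * (sin th) ^ 2 + s2)) 0 (PI / 2).

(* psi_1 = e^{i theta_alpha} * I1(|alpha|, s2), theta_0 := 0 *)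
Definition psi1 (alpha : Cpx) (s2 : R) : Cpx :=
  let m := Cmod alpha in
  if Req_EM_T m 0 then (I1 m s2, 0)
  else (fst alpha / m * I1 m s2, snd alpha / m * I1 m s2).

Definition psi2 (alpha : Cpx) (s2 delta sw2 : R) : R :=
  let m := Cmod alpha in
  4 / delta *
    (m ^ 2 + s2 + 1
     - RInt (fun th => (2 * m ^ 2 * (sin th) ^ 2 + s2)
                       / sqrt (m ^ 2 * (sin th) ^ 2 + s2)) 0 (PI / 2))
  + 4 * sw2.

Fixpoint SE (delta sw2 : R) (alpha0 : Cpx) (s0 : R) (t : nat) : Cpx * R :=
  match t with
  | O => (alpha0, s0)
  | S t' => let p := SE delta sw2 alpha0 s0 t' in
            (psi1 (fst p) (snd p), psi2 (fst p) (snd p) delta sw2)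
  end.

Definition mse_seq (delta sw2 : R) (alpha0 : Cpx) (s0 : R) (t : nat) : R :=
  let p := SE delta sw2 alpha0 s0 t in
  (1 - Cmod (fst p)) ^ 2 + snd p.

(* Main.v *)
(* With m = |alpha| and y = sigma^2 / m^2 the recursion becomes m' = phi y together with a formula
   for sigma^2' in terms of complete elliptic integrals, written below with x = 1 / (1 + y) as
   [rho] (increasing) and [ell] (convex); the basic relation is ell' = rho / 2.

   Global part. Let V be the larger of the current sigma^2 and of the value [barrier y] attached to
   the previous y. For delta > delta_AMP one step without noise sends sigma^2 below th * V, where
   th^2 = (4 / delta) / (4 / delta_AMP) < 1. This rests on the ordering of the two fixed-point curves
   and on convexity of [ell]; the lower bound (4 / delta) (1 - ell^2 / 4) that sigma^2 inherits from
   the previous step is needed for small |alpha|, where sigma^2' is not monotone in sigma^2. Hence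
   bounds on y shrink geometrically, and this tolerates a small noise until y reaches a fixed
   neighbourhood of 0.

   Local part. Near y = 0 one has 1 - phi y = o(sqrt y) and ell-terms of slope 1 / 2, so that
   y' = (2 / delta) y + 4 sigma_w^2 + o(y), which is a contraction once y is of order sigma_w^2.
   The limit is thus asymptotic to 4 sigma_w^2 / (1 - 2 / delta). *)
From Stdlib Require Import Reals Lra Lia Psatz Machin.
From Coquelicot Require Import Coquelicot.
Require Import Defs.
Open Scope R_scope.

(** The comparison of the fixed-point curves is tight at both ends. At [x = 0], where
    [rho 0 = PI / 4] and [ell 0 = PI / 2], the two sides of [fixed_curves_ordered] both equal
    [mcrit * (1 - mcrit)], which is what singles out delta_AMP; at [x = 1] both vanish. Hence the
    exact Taylor coefficients of the elliptic integrals at 0 and the sharp numerical constant near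
    1. The other obstacle is regularity: [phi] has logarithmically infinite slope at [y = 0], so the
    recursion cannot be linearised at its noiseless fixed point. The noise itself repairs this. It
    keeps [y] above [4 * w], where [phi] is Lipschitz with a constant of order [1 / sqrt w], and
    wherever that constant occurs it meets a factor of order [sqrt w]. As [a] lags one step behind
    [y], the recursion for [y] alone is of second order. *)

(** * Integration over the quarter period *)

Definition integ (f : R -> R) : R := Coquelicot.RInt.RInt f 0 (PI / 2).

Definition integrable (f : R -> R) : Prop := ex_RInt f 0 (PI / 2).

Lemma PI2_pos : 0 < PI / 2.
Proof. pose proof PI_RGT_0; lra. Qed.

Lemma sin_cos_sqr (t : R) : sin t ^ 2 = 1 - cos t ^ 2.
Proof. pose proof (sin2_cos2 t) as h; unfold Rsqr in h; lra. Qed.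

Lemma sin_nonneg_quarter (t : R) : 0 <= t <= PI / 2 -> 0 <= sin t <= 1.
Proof.
  intros ht; pose proof PI_RGT_0; split; [apply sin_ge_0; lra | apply SIN_bound].
Qed.

Lemma cos_nonneg_quarter (t : R) : 0 <= t <= PI / 2 -> 0 <= cos t <= 1.
Proof.
  intros ht; pose proof PI_RGT_0; split; [apply cos_ge_0; lra | apply COS_bound].
Qed.

Lemma integrable_continuous (f : R -> R) :
  (forall t, continuous f t) -> integrable f.
Proof. intros h; apply (ex_RInt_continuous (V := R_CompleteNormedModule)); auto. Qed.

Lemma integrable_ext (f g : R -> R) :
  (forall t, 0 < t < PI / 2 -> f t = g t) -> integrable f -> integrable g.
Proof.
  intros h; apply ex_RInt_ext; pose proof PI2_pos.
  rewrite Rmin_left, Rmax_right by lra; auto.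
Qed.

Lemma integ_ext (f g : R -> R) :
  (forall t, 0 < t < PI / 2 -> f t = g t) -> integ f = integ g.
Proof.
  intros h; apply RInt_ext; pose proof PI2_pos.
  rewrite Rmin_left, Rmax_right by lra; auto.
Qed.

Lemma integ_le (f g : R -> R) :
  integrable f -> integrable g ->
  (forall t, 0 < t < PI / 2 -> f t <= g t) -> integ f <= integ g.
Proof. intros; apply RInt_le; auto; pose proof PI2_pos; lra. Qed.

Lemma integrable_lin (f g : R -> R) (a b : R) :
  integrable f -> integrable g -> integrable (fun t => a * f t + b * g t).
Proof.
  intros hf hg.
  apply (ex_RInt_plus (V := R_NormedModule) (fun t => a * f t) (fun t => b * g t));
  [apply (ex_RInt_scal (V := R_NormedModule) f) | apply (ex_RInt_scal (V := R_NormedModule) g)];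
  assumption.
Qed.

Lemma integ_lin (f g : R -> R) (a b : R) :
  integrable f -> integrable g ->
  integ (fun t => a * f t + b * g t) = a * integ f + b * integ g.
Proof.
  intros hf hg; unfold integ.
  rewrite (RInt_plus (V := R_CompleteNormedModule) (fun t => a * f t) (fun t => b * g t)).
  - rewrite (RInt_scal (V := R_CompleteNormedModule) f),
      (RInt_scal (V := R_CompleteNormedModule) g); auto.
  - apply (ex_RInt_scal (V := R_NormedModule) f); auto.
  - apply (ex_RInt_scal (V := R_NormedModule) g); auto.
Qed.

Lemma integrable_scal (f : R -> R) (a : R) :
  integrable f -> integrable (fun t => a * f t).
Proof. intros h; apply (ex_RInt_scal (V := R_NormedModule) f); auto. Qed.

Lemma integ_scal (f : R -> R) (a : R) :
  integrable f -> integ (fun t => a * f t) = a * integ f.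
Proof. intros h; apply (RInt_scal (V := R_CompleteNormedModule) f); auto. Qed.

Lemma integ_const (a : R) : integ (fun _ => a) = a * (PI / 2).
Proof. unfold integ; rewrite RInt_const; unfold scal; simpl; unfold mult; simpl; lra. Qed.

Lemma integrable_const (a : R) : integrable (fun _ => a).
Proof. apply ex_RInt_const. Qed.

Lemma integ_derive (F f : R -> R) :
  (forall t, 0 <= t <= PI / 2 -> is_derive F t (f t)) ->
  (forall t, 0 <= t <= PI / 2 -> continuous f t) ->
  integrable f /\ integ f = F (PI / 2) - F 0.
Proof.
  intros h1 h2; pose proof PI2_pos.
  assert (h : is_RInt f 0 (PI / 2) (F (PI / 2) - F 0)).
  { apply (is_RInt_derive F f); rewrite Rmin_left, Rmax_right by lra; auto. }
  split; [eexists; exact h | apply is_RInt_unique; exact h].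
Qed.

Lemma continuous_of_derive (f : R -> R) (t : R) : ex_derive f t -> continuous f t.
Proof. apply (ex_derive_continuous (V := R_NormedModule)). Qed.

Lemma integ_sin : integrable sin /\ integ sin = 1.
Proof.
  destruct (integ_derive (fun t => - cos t) sin) as [h1 h2].
  - intros t _; auto_derive; auto; ring.
  - intros t _; apply continuous_of_derive; auto_derive; auto.
  - split; auto; rewrite h2, cos_PI2, cos_0; ring.
Qed.

Lemma integ_cos : integrable cos /\ integ cos = 1.
Proof.
  destruct (integ_derive sin cos) as [h1 h2].
  - intros t _; auto_derive; auto; ring.
  - intros t _; apply continuous_of_derive; auto_derive; auto.
  - split; auto; rewrite h2, sin_PI2, sin_0; ring.
Qed.

Lemma integ_sin_cos : integrable (fun t => sin t * cos t) /\ integ (fun t => sin t * cos t) = 1 / 2.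
Proof.
  destruct (integ_derive (fun t => sin t ^ 2 / 2) (fun t => sin t * cos t)) as [h1 h2].
  - intros t _; auto_derive; auto; field.
  - intros t _; apply continuous_of_derive; auto_derive; auto.
  - split; auto; rewrite h2, sin_PI2, sin_0; field.
Qed.

Definition wallis (n : nat) : R := integ (fun t => cos t ^ n).

Lemma integrable_cos_pow (n : nat) : integrable (fun t => cos t ^ n).
Proof. apply integrable_continuous; intros t; apply continuous_of_derive; auto_derive; auto. Qed.

(** The function [sin t * cos t ^ (n + 1)] vanishes at both ends, so its derivative integrates to
    0. *)
Lemma wallis_rec (n : nat) : INR (n + 2) * wallis (n + 2) = INR (n + 1) * wallis n.
Proof.
  destruct (integ_derive (fun t => sin t * cos t ^ (n + 1))
    (fun t => INR (n + 2) * cos t ^ (n + 2) + (- INR (n + 1)) * cos t ^ n)) as [h1 h2].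
  - intros t _; auto_derive; auto.
    replace (n + 2)%nat with (S (S n)) by lia; replace (n + 1)%nat with (S n) by lia.
    rewrite !S_INR; simpl pred; pose proof (sin_cos_sqr t) as e.
    simpl pow; simpl in e; revert e.
    generalize (cos t ^ n); generalize (sin t), (cos t), (INR n); intros s c k p e.
    apply Rminus_diag_uniq; transitivity (- (k + 1) * p * (s * (s * 1) - (1 - c * (c * 1))));
      [ring | rewrite e; ring].
  - intros t _; apply continuous_of_derive; auto_derive; auto.
  - rewrite integ_lin in h2 by apply integrable_cos_pow.
    rewrite sin_0, cos_PI2, pow_i in h2 by lia; unfold wallis; lra.
Qed.

Lemma wallis_even :
  wallis 0 = PI / 2 /\ wallis 2 = PI / 4 /\ wallis 4 = 3 * PI / 16 /\ wallis 6 = 5 * PI / 32 /\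
  wallis 8 = 35 * PI / 256 /\ wallis 10 = 63 * PI / 512.
Proof.
  assert (h0 : wallis 0 = PI / 2) by (unfold wallis; simpl; rewrite integ_const; ring).
  pose proof (wallis_rec 0) as h2; pose proof (wallis_rec 2) as h4; pose proof (wallis_rec 4) as h6;
  pose proof (wallis_rec 6) as h8; pose proof (wallis_rec 8) as h10.
  cbn [Nat.add] in *; rewrite !INR_IZR_INZ in *; simpl Z.of_nat in *.
  repeat split; lra.
Qed.

(** * The elliptic integrals *)

(** Taking [a ^ 2 + s] out of [a ^ 2 * sin t ^ 2 + s] leaves [1 - x * cos t ^ 2] with
    [x = a ^ 2 / (a ^ 2 + s)]: this is the radical common to all the SE integrals. *)
Definition Rad (x t : R) : R := sqrt (1 - x * cos t ^ 2).

(** For [x > 0] and k = sqrt x this is (E(k) - (1 - k^2) K(k)) / k^2. *)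
Definition rho (x : R) : R := integ (fun t => sin t ^ 2 / Rad x t).

(* With k = sqrt x, [ell x] is 2 E(k) - (1 - k^2) K(k) in terms of complete elliptic integrals. *)
Definition ell (x : R) : R := integ (fun t => 2 * Rad x t - (1 - x) / Rad x t).

Lemma cos_sqr_bound (t : R) : 0 <= cos t ^ 2 <= 1.
Proof.
  pose proof (sin_cos_sqr t); pose proof (pow2_ge_0 (sin t)); pose proof (pow2_ge_0 (cos t)); lra.
Qed.

Lemma rad_arg_pos (x t : R) : x < 1 -> 0 < 1 - x * cos t ^ 2.
Proof. intros hx; pose proof (cos_sqr_bound t); destruct (Rle_dec x 0); nra. Qed.

Lemma Rad_pos (x t : R) : x < 1 -> 0 < Rad x t.
Proof. intros hx; apply sqrt_lt_R0, rad_arg_pos, hx. Qed.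

Lemma Rad_sqr (x t : R) : x <= 1 -> Rad x t ^ 2 = 1 - x * cos t ^ 2.
Proof.
  intros hx; apply pow2_sqrt; pose proof (cos_sqr_bound t); nra.
Qed.

Lemma Rad_one (t : R) : 0 <= t <= PI / 2 -> Rad 1 t = sin t.
Proof.
  intros ht; unfold Rad; rewrite Rmult_1_l, <- sin_cos_sqr.
  apply sqrt_pow2, sin_nonneg_quarter, ht.
Qed.

Lemma Rad_pos_inner (x t : R) : x <= 1 -> 0 < t < PI / 2 -> 0 < Rad x t.
Proof.
  intros hx ht; destruct (Req_dec x 1) as [-> | hn].
  - rewrite Rad_one by lra; pose proof PI_RGT_0; apply sin_gt_0; lra.
  - apply Rad_pos; lra.
Qed.

Lemma Rad_le (x t : R) : x <= 1 -> 0 <= x -> sqrt (1 - x) <= Rad x t <= 1.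
Proof.
  intros h1 h0; pose proof (cos_sqr_bound t); split.
  - apply sqrt_le_1_alt; nra.
  - rewrite <- sqrt_1; apply sqrt_le_1_alt; nra.
Qed.

Lemma Rad_anti (x y t : R) : x <= y -> Rad y t <= Rad x t.
Proof. intros h; apply sqrt_le_1_alt; pose proof (cos_sqr_bound t); nra. Qed.

Lemma Rad_ge_sin (x t : R) : x <= 1 -> 0 <= t <= PI / 2 -> sin t <= Rad x t.
Proof. intros h ht; rewrite <- (Rad_one t) by auto; apply Rad_anti, h. Qed.

Lemma Rad_derive (x t : R) : x < 1 ->
  is_derive (fun u => Rad u t) x (- cos t ^ 2 / (2 * Rad x t)).
Proof.
  intros hx; unfold Rad; pose proof (rad_arg_pos x t hx); auto_derive; [lra | ].
  change (1 + - (x * (cos t * (cos t * 1)))) with (1 - x * cos t ^ 2); field.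
  apply Rgt_not_eq, sqrt_lt_R0; lra.
Qed.

Lemma Rad_derive_angle (x t : R) : x < 1 ->
  is_derive (Rad x) t (x * cos t * sin t / Rad x t).
Proof.
  intros hx; unfold Rad; pose proof (rad_arg_pos x t hx); auto_derive; [lra | ].
  change (1 + - (x * (cos t * (cos t * 1)))) with (1 - x * cos t ^ 2); field.
  apply Rgt_not_eq, sqrt_lt_R0; lra.
Qed.

Lemma Rad_ex_derive_angle (x t : R) : x < 1 -> ex_derive (Rad x) t.
Proof. intros hx; eexists; apply Rad_derive_angle, hx. Qed.

Lemma rho_integrable (x : R) : x <= 1 -> integrable (fun t => sin t ^ 2 / Rad x t).
Proof.
  intros hx; destruct (Req_dec x 1) as [-> | hn].
  - apply integrable_ext with sin; [ | apply integ_sin].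
    intros t ht; pose proof (Rad_pos_inner 1 t hx ht) as hp.
    rewrite Rad_one in * by lra; field; lra.
  - apply integrable_continuous; intros t; apply continuous_of_derive.
    pose proof (Rad_ex_derive_angle x t ltac:(lra)); pose proof (Rad_pos x t ltac:(lra)).
    auto_derive; repeat split; auto; lra.
Qed.

Lemma ell_integrable (x : R) : x <= 1 -> integrable (fun t => 2 * Rad x t - (1 - x) / Rad x t).
Proof.
  intros hx; destruct (Req_dec x 1) as [-> | hn].
  - apply integrable_ext with (fun t => 2 * sin t); [ | apply integrable_scal, integ_sin].
    intros t ht; pose proof (Rad_pos_inner 1 t hx ht) as hp.
    rewrite Rad_one in * by lra; field; lra.
  - apply integrable_continuous; intros t; apply continuous_of_derive.
    pose proof (Rad_ex_derive_angle x t ltac:(lra)); pose proof (Rad_pos x t ltac:(lra)).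
    auto_derive; repeat split; auto; lra.
Qed.

Lemma rho_one : rho 1 = 1.
Proof.
  transitivity (integ sin); [ | apply integ_sin]; apply integ_ext; intros t ht.
  pose proof (Rad_pos_inner 1 t (Rle_refl 1) ht) as hp.
  rewrite Rad_one in * by lra; field; lra.
Qed.

Lemma ell_one : ell 1 = 2.
Proof.
  transitivity (integ (fun t => 2 * sin t));
    [ | rewrite integ_scal by apply integ_sin; rewrite (proj2 integ_sin); ring].
  apply integ_ext; intros t ht; pose proof (Rad_pos_inner 1 t (Rle_refl 1) ht) as hp.
  rewrite Rad_one in * by lra; field; lra.
Qed.

Lemma Rad_zero (t : R) : Rad 0 t = 1.
Proof. unfold Rad; replace (1 - 0 * cos t ^ 2) with 1 by ring; apply sqrt_1. Qed.

Lemma ell_zero : ell 0 = PI / 2.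
Proof.
  unfold ell; rewrite (integ_ext _ (fun _ => 1)).
  - rewrite integ_const; ring.
  - intros t _; rewrite Rad_zero; field.
Qed.

Lemma rho_incr (x y : R) : x <= y -> y <= 1 -> rho x <= rho y.
Proof.
  intros h h1; apply integ_le; try apply rho_integrable; try lra.
  intros t ht; pose proof (Rad_pos_inner y t h1 ht); pose proof (Rad_anti x y t h).
  apply Rmult_le_compat_l; [apply pow2_ge_0 | apply Rinv_le_contravar; auto].
Qed.

Lemma rho_le_one (x : R) : x <= 1 -> rho x <= 1.
Proof. intros h; rewrite <- rho_one; apply rho_incr; lra. Qed.

(* The [x]-derivative of the integrand of [ell] is half the integrand of [rho]
   up to the total [t]-derivative of [sin t * cos t / Rad x t]. *)
Lemma ell_derive (x : R) : x < 1 -> is_derive ell x (rho x / 2).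
Proof.
  intros hx.
  set (h := fun u t => 2 * Rad u t - (1 - u) / Rad u t).
  set (dh := fun u t => sin t ^ 2 / Rad u t - (1 - u) * cos t ^ 2 / (2 * Rad u t ^ 3)).
  assert (hd : forall u t, u < 1 -> is_derive (fun v => h v t) u (dh u t)).
  { intros u t hu; unfold h, dh; pose proof (Rad_derive u t hu) as hr.
    pose proof (Rad_pos u t hu) as hp; pose proof (Rad_sqr u t ltac:(lra)) as hq.
    auto_derive; [repeat split; try lra; eexists; exact hr | ].
    replace (Derive (fun v : R => Rad v t) u) with (- cos t ^ 2 / (2 * Rad u t))
      by (symmetry; exact (is_derive_unique _ _ _ hr)).
    rewrite sin_cos_sqr; field; lra. }
  assert (loc : locally x (fun u => u < 1)) by (apply open_lt; exact hx).
  assert (hD : is_derive ell x (integ (fun t => Derive (fun u => h u t) x))).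
  { apply (is_derive_RInt_param h 0 (PI / 2) x).
    - revert loc; apply filter_imp; intros u hu t _; eexists; apply hd, hu.
    - intros t _; apply continuity_2d_pt_ext_loc with dh.
      + destruct loc as [e he]; exists e; intros u v hu hv; symmetry.
        apply is_derive_unique, hd, he, hu.
      + pose proof (Rad_pos x t hx) as hp.
        assert (c1 : continuity_2d_pt Rad x t).
        { unfold Rad; apply (continuity_1d_2d_pt_comp sqrt (fun u v => 1 - u * cos v ^ 2)).
          - apply continuity_pt_sqrt; pose proof (rad_arg_pos x t hx); lra.
          - apply continuity_2d_pt_minus; [apply continuity_2d_pt_const | ].
            apply continuity_2d_pt_mult; [apply continuity_2d_pt_id1 | ].
            apply (continuity_1d_2d_pt_comp (fun v => cos v ^ 2) (fun _ v => v));
              [ | apply continuity_2d_pt_id2].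
            apply continuity_pt_filterlim, (continuous_of_derive (fun v => cos v ^ 2)).
            auto_derive; auto. }
        assert (c2 : forall f : R -> R, (forall v, ex_derive f v) ->
                     continuity_2d_pt (fun _ v => f v) x t).
        { intros f hf; apply (continuity_1d_2d_pt_comp f (fun _ v => v));
            [ | apply continuity_2d_pt_id2].
          apply continuity_pt_filterlim, (continuous_of_derive f), hf. }
        apply continuity_2d_pt_minus; unfold Rdiv; apply continuity_2d_pt_mult.
        * apply (c2 (fun v => sin v ^ 2)); intros v; auto_derive; auto.
        * apply continuity_2d_pt_inv; auto; lra.
        * apply continuity_2d_pt_mult.
          -- apply continuity_2d_pt_minus;
               [apply continuity_2d_pt_const | apply continuity_2d_pt_id1].
          -- apply (c2 (fun v => cos v ^ 2)); intros v; auto_derive; auto.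
        * apply continuity_2d_pt_inv.
          -- apply continuity_2d_pt_mult; [apply continuity_2d_pt_const | ].
             apply (continuity_2d_pt_ext (fun u v => Rad u v * (Rad u v * Rad u v)));
               [intros; ring | repeat apply continuity_2d_pt_mult; auto].
          -- apply Rgt_not_eq, Rmult_lt_0_compat; [lra | apply pow_lt, hp].
    - revert loc; apply filter_imp; intros u hu; apply ell_integrable; lra. }
  destruct (integ_derive (fun t => sin t * cos t / Rad x t)
    (fun t => (1 - x) * cos t ^ 2 / Rad x t ^ 3 - sin t ^ 2 / Rad x t)) as [i1 i2].
  - intros t _; pose proof (Rad_derive_angle x t hx) as hr.
    pose proof (Rad_pos x t hx) as hp; pose proof (Rad_sqr x t ltac:(lra)) as hq.
    auto_derive; [repeat split; try lra; eexists; exact hr | ].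
    replace (Derive (fun v : R => Rad x v) t) with (x * cos t * sin t / Rad x t)
      by (symmetry; exact (is_derive_unique _ _ _ hr)).
    apply Rmult_eq_reg_r with (Rad x t ^ 3); [ | apply Rgt_not_eq, pow_lt, hp].
    transitivity ((cos t ^ 2 - sin t ^ 2) * Rad x t ^ 2 - x * (cos t ^ 2) * sin t ^ 2);
      [field; lra | ].
    transitivity ((1 - x) * cos t ^ 2 - sin t ^ 2 * Rad x t ^ 2); [ | field; lra].
    rewrite hq, sin_cos_sqr; ring.
  - intros t _; apply continuous_of_derive.
    pose proof (Rad_ex_derive_angle x t ltac:(lra)); pose proof (Rad_pos x t ltac:(lra)).
    assert (Rad x t ^ 3 <> 0) by (apply Rgt_not_eq, pow_lt; lra).
    auto_derive; repeat split; auto; lra.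
  - rewrite cos_PI2, sin_0 in i2.
    replace (rho x / 2) with (integ (fun t => Derive (fun u => h u t) x)); [exact hD | ].
    rewrite (integ_ext _ (fun t => (1 / 2) * (sin t ^ 2 / Rad x t) +
       (- 1 / 2) * ((1 - x) * cos t ^ 2 / Rad x t ^ 3 - sin t ^ 2 / Rad x t))).
    + rewrite integ_lin, i2 by (auto; apply rho_integrable; lra); unfold rho; lra.
    + intros t _; transitivity (dh x t);
        [exact (is_derive_unique _ _ _ (hd x t hx)) | unfold dh].
      field; pose proof (Rad_pos x t hx); lra.
Qed.

(** * Convexity of [ell] up to the endpoint [x = 1] *)

(** [Rad 1] vanishes at [t = 0], so differentiation under the integral stops short of [x = 1].
    Continuity there comes from pointwise bounds: [(1 - x) / Rad x t] and [Rad x t - sin t] are both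
    at most [sqrt (1 - x)]. *)
Lemma ell_near_one (x : R) : 0 <= x < 1 -> Rabs (ell x - 2) <= 6 * sqrt (1 - x).
Proof.
  intros hx; rewrite <- ell_one; set (z := sqrt (1 - x)).
  assert (hz : 0 < z) by (apply sqrt_lt_R0; lra).
  assert (hz2 : z ^ 2 = 1 - x) by (apply pow2_sqrt; lra).
  pose proof PI_4 as hpi; pose proof PI2_pos.
  assert (pt : forall t, 0 < t < PI / 2 ->
    - z <= (2 * Rad x t - (1 - x) / Rad x t) - (2 * Rad 1 t - (1 - 1) / Rad 1 t) <= 2 * z).
  { intros t ht; pose proof (Rad_pos x t (proj2 hx)) as hp.
    pose proof (Rad_le x t ltac:(lra) ltac:(lra)) as hl; fold z in hl.
    pose proof (Rad_sqr x t ltac:(lra)) as hq.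
    pose proof (Rad_pos_inner 1 t ltac:(lra) ht) as hp1.
    pose proof (Rad_anti x 1 t ltac:(lra)).
    rewrite Rad_one in * by lra.
    pose proof (sin_cos_sqr t) as hs; pose proof (cos_sqr_bound t).
    replace ((1 - 1) / sin t) with 0 by (field; lra).
    assert (0 <= (1 - x) / Rad x t <= z).
    { split; [apply Rdiv_le_0_compat; lra | ].
      apply Rle_div_l; [lra | rewrite <- hz2; nra]. }
    assert (Rad x t <= sin t + z) by (apply Rsqr_incr_0_var; unfold Rsqr; nra).
    lra. }
  assert (i1 := ell_integrable x ltac:(lra)); assert (i2 := ell_integrable 1 ltac:(lra)).
  assert (lo : ell 1 + - z * (PI / 2) <= ell x).
  { rewrite <- integ_const.
    replace (ell 1 + integ (fun _ => - z)) with
      (integ (fun t => 1 * (2 * Rad 1 t - (1 - 1) / Rad 1 t) + 1 * (- z))).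
    - apply integ_le; auto; [apply integrable_lin; auto; apply integrable_const | ].
      intros t ht; specialize (pt t ht); lra.
    - rewrite integ_lin; auto; [unfold ell; lra | apply integrable_const]. }
  assert (hi : ell x <= ell 1 + 2 * z * (PI / 2)).
  { rewrite <- integ_const.
    replace (ell 1 + integ (fun _ => 2 * z)) with
      (integ (fun t => 1 * (2 * Rad 1 t - (1 - 1) / Rad 1 t) + 1 * (2 * z))).
    - apply integ_le; auto; [apply integrable_lin; auto; apply integrable_const | ].
      intros t ht; specialize (pt t ht); lra.
    - rewrite integ_lin; auto; [unfold ell; lra | apply integrable_const]. }
  apply Rabs_le; nra.
Qed.

Lemma ell_bounds_lt (x y : R) : x <= y -> y < 1 ->
  (y - x) * rho x / 2 <= ell y - ell x <= (y - x) * rho y / 2.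
Proof.
  intros h hy.
  destruct (MVT_gen ell x y (fun u => rho u / 2)) as [u [hu e]].
  - intros u; rewrite Rmin_left, Rmax_right by lra; intros; apply ell_derive; lra.
  - intros u; rewrite Rmin_left, Rmax_right by lra; intros hu.
    apply continuity_pt_filterlim, (continuous_of_derive ell).
    eexists; apply ell_derive; lra.
  - rewrite Rmin_left, Rmax_right in hu by lra; rewrite e.
    pose proof (rho_incr x u ltac:(lra) ltac:(lra));
    pose proof (rho_incr u y ltac:(lra) ltac:(lra)); nra.
Qed.

Lemma ell_cont_one (e x : R) : 0 < e -> 0 <= x < 1 ->
  exists y, x <= y < 1 /\ 1 - y <= e /\ Rabs (ell y - 2) <= e.
Proof.
  intros he hx; set (m := Rmin 1 (e / 6)).
  assert (hm : 0 < m <= 1) by (unfold m; split; [apply Rmin_pos | apply Rmin_l]; lra).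
  assert (hm2 : m <= e / 6) by apply Rmin_r.
  exists (Rmax x (1 - m ^ 2)); pose proof (Rmax_l x (1 - m ^ 2)); pose proof (Rmax_r x (1 - m ^ 2)).
  assert (Rmax x (1 - m ^ 2) < 1) by (apply Rmax_lub_lt; nra).
  repeat split; auto; [nra | ].
  eapply Rle_trans; [apply ell_near_one; lra | ].
  assert (sqrt (1 - Rmax x (1 - m ^ 2)) <= m); [ | lra].
  apply Rle_trans with (sqrt (m ^ 2)); [apply sqrt_le_1_alt | right; apply sqrt_pow2]; lra.
Qed.

(** The tangent inequalities of a convex function with derivative [rho / 2]; the endpoint [y = 1] is
    reached by continuity only. *)
Lemma ell_bounds (x y : R) : 0 <= x <= y -> y <= 1 ->
  (y - x) * rho x / 2 <= ell y - ell x <= (y - x) * rho y / 2.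
Proof.
  intros h hy; destruct (Req_dec y 1) as [-> | hn]; [ | apply ell_bounds_lt; lra].
  destruct (Req_dec x 1) as [-> | hx]; [lra | ].
  rewrite rho_one, ell_one; pose proof (rho_le_one x ltac:(lra)) as hr.
  assert (hr0 : 0 <= rho x).
  { rewrite <- (Rmult_0_l (PI / 2)), <- integ_const; apply integ_le;
      [apply integrable_const | apply rho_integrable; lra | ].
    intros t ht; apply Rdiv_le_0_compat; [apply pow2_ge_0 | apply Rad_pos; lra]. }
  split; apply le_epsilon; intros e he;
    destruct (ell_cont_one (e / 2) x ltac:(lra) ltac:(lra)) as [u [hu [h1 h2]]];
    pose proof (ell_bounds_lt x u ltac:(lra) ltac:(lra));
    pose proof (rho_le_one u ltac:(lra));
    apply Rabs_le_between in h2; nra.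
Qed.

Lemma rho_nonneg (x : R) : x <= 1 -> 0 <= rho x.
Proof.
  intros h; rewrite <- (Rmult_0_l (PI / 2)), <- integ_const; apply integ_le;
    [apply integrable_const | apply rho_integrable; lra | ].
  intros t ht; apply Rdiv_le_0_compat; [apply pow2_ge_0 | apply Rad_pos_inner; lra].
Qed.

(** * Taylor lower bounds at [x = 0] *)

(** The Taylor polynomial of degree 4 of [4 / PI * rho] at 0. *)
Definition rho_poly (x : R) : R :=
  1 + x / 8 + 3 * x ^ 2 / 64 + 25 * x ^ 3 / 1024 + 245 * x ^ 4 / 16384.

(** The Taylor polynomial of degree 3 of [4 / PI * ell] at 0. *)
Definition ell_poly (x : R) : R := 2 + x / 2 + x ^ 2 / 32 + x ^ 3 / 128.

(** For the truncated binomial series [P] of (1 - u)^(-1/2), the difference 1 - P^2 (1 - u) starts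
    at u^5 and has positive coefficients only. *)
Lemma inv_sqrt_taylor (u r : R) : 0 <= u -> 0 < r -> r ^ 2 = 1 - u ->
  1 + u / 2 + 3 * u ^ 2 / 8 + 5 * u ^ 3 / 16 + 35 * u ^ 4 / 128 <= / r.
Proof.
  intros hu hr h; assert (u < 1) by nra.
  set (P := 1 + u / 2 + 3 * u ^ 2 / 8 + 5 * u ^ 3 / 16 + 35 * u ^ 4 / 128).
  assert (hP : 0 < P) by (unfold P; pose proof (pow_le u 3 hu); pose proof (pow_le u 4 hu); nra).
  apply Rmult_le_reg_r with r; [lra | rewrite Rinv_l by lra].
  apply Rsqr_incr_0_var; [ | lra]; unfold Rsqr.
  replace (P * r * (P * r)) with (P ^ 2 * r ^ 2) by ring; rewrite h.
  assert (e : 1 * 1 - P ^ 2 * (1 - u) = u ^ 5 * (63 / 128 + 105 / 512 * u + 135 / 1024 * u ^ 2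
    + 1575 / 16384 * u ^ 3 + 1225 / 16384 * u ^ 4)) by (unfold P; field).
  assert (0 <= u ^ 5 * (63 / 128 + 105 / 512 * u + 135 / 1024 * u ^ 2
    + 1575 / 16384 * u ^ 3 + 1225 / 16384 * u ^ 4)).
  { pose proof (pow_le u 2 hu); pose proof (pow_le u 3 hu); pose proof (pow_le u 4 hu).
    apply Rmult_le_pos; [apply pow_le; lra | lra]. }
  lra.
Qed.

Lemma rho_ge_poly (x : R) : 0 <= x <= 1 -> PI / 4 * rho_poly x <= rho x.
Proof.
  intros hx; destruct wallis_even as [w0 [w2 [w4 [w6 [w8 w10]]]]].
  assert (lin : forall n a b f v, integrable f /\ integ f = v ->
    integrable (fun t => a * cos t ^ n + b * f t) /\
    integ (fun t => a * cos t ^ n + b * f t) = a * wallis n + b * v).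
  { intros n a b f v [h1 <-]; split; [apply integrable_lin | apply integ_lin];
      auto; apply integrable_cos_pow. }
  (* Writing sin^2 as 1 - cos^2 makes each coefficient of an even power of [cos t] a difference of
     two consecutive binomial terms. *)
  pose proof (lin 0%nat 1 1 _ _ (lin 2%nat (x / 2 - 1) 1 _ _
    (lin 4%nat (3 * x ^ 2 / 8 - x / 2) 1 _ _
    (lin 6%nat (5 * x ^ 3 / 16 - 3 * x ^ 2 / 8) 1 _ _
    (lin 8%nat (35 * x ^ 4 / 128 - 5 * x ^ 3 / 16) (- (35 * x ^ 4 / 128)) _ _
    (conj (integrable_cos_pow 10) eq_refl)))))) as [hf hv].
  replace (PI / 4 * rho_poly x) with
    (1 * wallis 0 + 1 * ((x / 2 - 1) * wallis 2 +
     1 * ((3 * x ^ 2 / 8 - x / 2) * wallis 4 + 1 * ((5 * x ^ 3 / 16 - 3 * x ^ 2 / 8) * wallis 6 +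
     1 * ((35 * x ^ 4 / 128 - 5 * x ^ 3 / 16) * wallis 8 + - (35 * x ^ 4 / 128) * wallis 10)))))
    by (rewrite w0, w2, w4, w6, w8, w10; unfold rho_poly; field).
  change (integ (fun t => cos t ^ 10)) with (wallis 10) in hv.
  rewrite <- hv; apply integ_le; [exact hf | apply rho_integrable; lra | ].
  intros t ht; pose proof (Rad_pos_inner x t ltac:(lra) ht) as hp.
  pose proof (Rad_sqr x t ltac:(lra)) as hq; pose proof (cos_sqr_bound t).
  pose proof (inv_sqrt_taylor (x * cos t ^ 2) (Rad x t) ltac:(nra) hp hq) as h.
  pose proof (pow2_ge_0 (sin t)) as hs; pose proof (Rmult_le_compat_l _ _ _ hs h) as h'.
  unfold Rdiv at 1; eapply Rle_trans; [ | exact h'].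
  rewrite sin_cos_sqr; right; field.
Qed.

Lemma ell_ge_poly (x : R) : 0 <= x < 1 -> PI / 4 * ell_poly x <= ell x.
Proof.
  intros hx; set (d := fun u => rho u / 2 - PI / 4 * (1 / 2 + u / 16 + 3 * u ^ 2 / 128)).
  assert (hd : forall u, u < 1 -> is_derive (fun v => ell v - PI / 4 * ell_poly v) u (d u)).
  { intros u hu; pose proof (ell_derive u hu) as he; unfold ell_poly, d.
    auto_derive; [eexists; exact he | ].
    replace (Derive (fun v : R => ell v) u) with (rho u / 2)
      by (symmetry; exact (is_derive_unique _ _ _ he)).
    field. }
  destruct (MVT_gen (fun v => ell v - PI / 4 * ell_poly v) 0 x d) as [u [hu e]].
  - intros u; rewrite Rmin_left, Rmax_right by lra; intros; apply hd; lra.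
  - intros u; rewrite Rmin_left, Rmax_right by lra; intros hu.
    apply continuity_pt_filterlim, (continuous_of_derive (fun v => ell v - PI / 4 * ell_poly v)).
    eexists; apply hd; lra.
  - rewrite Rmin_left, Rmax_right in hu by lra.
    pose proof (rho_ge_poly u ltac:(lra)) as hr; pose proof PI_RGT_0.
    assert (0 <= d u).
    { unfold d; unfold rho_poly in hr.
      assert (0 <= PI / 4 * (25 * u ^ 3 / 1024 + 245 * u ^ 4 / 16384)).
      { pose proof (pow_le u 3 ltac:(lra)); pose proof (pow_le u 4 ltac:(lra)).
        apply Rmult_le_pos; lra. }
      lra. }
    rewrite ell_zero in e; assert (0 <= d u * (x - 0)) by (apply Rmult_le_pos; lra).
    unfold ell_poly in *; lra.
Qed.

Lemma ell_ge_near_one (x : R) : 0 <= x <= 1 -> 2 - (1 - x) / 2 <= ell x.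
Proof.
  intros hx; pose proof (ell_bounds x 1 ltac:(lra) ltac:(lra)) as h.
  rewrite ell_one, rho_one in h; lra.
Qed.

Lemma ell_le_two (x : R) : 0 <= x <= 1 -> ell x <= 2.
Proof.
  intros hx; pose proof (ell_bounds x 1 ltac:(lra) ltac:(lra)) as h.
  rewrite ell_one in h; pose proof (rho_nonneg x ltac:(lra)); nra.
Qed.

Lemma ell_ge_tangent_zero (x : R) : 0 <= x <= 1 -> PI / 2 + PI / 8 * x <= ell x.
Proof.
  intros hx; pose proof (ell_bounds 0 x ltac:(lra) ltac:(lra)) as h.
  pose proof (rho_ge_poly 0 ltac:(lra)) as h0; unfold rho_poly in h0; rewrite ell_zero in h.
  assert (PI / 4 <= rho 0) by lra; pose proof PI_RGT_0; nra.
Qed.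

Lemma ell_le_chord (x : R) : 0 <= x <= 1 -> ell x <= (1 - x) * (PI / 2) + x * 2.
Proof.
  intros hx; pose proof (ell_bounds 0 x ltac:(lra) ltac:(lra)) as h.
  pose proof (ell_bounds x 1 ltac:(lra) ltac:(lra)) as h1.
  rewrite ell_zero in h; rewrite ell_one in h1; nra.
Qed.

Lemma ell_ge_tangent (x y : R) : 0 <= x <= 1 -> 0 <= y <= 1 ->
  ell x + (y - x) * rho x / 2 <= ell y.
Proof.
  intros hx hy; destruct (Rle_dec x y).
  - pose proof (ell_bounds x y ltac:(lra) ltac:(lra)); lra.
  - pose proof (ell_bounds y x ltac:(lra) ltac:(lra)); lra.
Qed.

(* Monotonicity of [(1 - x) / (1 - x * cos t ^ 2)] under the integral. *)
Lemma rho_weighted_anti (x y : R) : 0 <= x <= y -> y <= 1 ->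
  (1 - y) * rho y ^ 2 <= (1 - x) * rho x ^ 2.
Proof.
  intros h hy; pose proof (rho_nonneg y hy); pose proof (rho_nonneg x ltac:(lra)).
  set (a := sqrt (1 - y)); set (b := sqrt (1 - x)).
  assert (ha : a ^ 2 = 1 - y) by (apply pow2_sqrt; lra).
  assert (hb : b ^ 2 = 1 - x) by (apply pow2_sqrt; lra).
  pose proof (sqrt_pos (1 - y)) as ha0; pose proof (sqrt_pos (1 - x)) as hb0; fold a in ha0; fold b in hb0.
  assert (a * rho y <= b * rho x).
  { unfold rho; rewrite <- !integ_scal by (apply rho_integrable; lra).
    apply integ_le; [apply integrable_scal, rho_integrable; lra.. | ].
    intros t ht; pose proof (Rad_pos_inner y t hy ht); pose proof (Rad_pos_inner x t ltac:(lra) ht).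
    assert (a * Rad x t <= b * Rad y t).
    { apply Rsqr_incr_0_var; [ | apply Rmult_le_pos; lra]; unfold Rsqr.
      replace (a * Rad x t * (a * Rad x t)) with (a ^ 2 * Rad x t ^ 2) by ring.
      replace (b * Rad y t * (b * Rad y t)) with (b ^ 2 * Rad y t ^ 2) by ring.
      rewrite ha, hb, !Rad_sqr by lra; pose proof (cos_sqr_bound t); nra. }
    apply Rmult_le_reg_r with (Rad x t * Rad y t); [apply Rmult_lt_0_compat; lra | ].
    replace (a * (sin t ^ 2 / Rad y t) * (Rad x t * Rad y t)) with (sin t ^ 2 * (a * Rad x t))
      by (field; lra).
    replace (b * (sin t ^ 2 / Rad x t) * (Rad x t * Rad y t)) with (sin t ^ 2 * (b * Rad y t))
      by (field; lra).
    apply Rmult_le_compat_l; [apply pow2_ge_0 | auto]. }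
  rewrite <- ha, <- hb; assert (0 <= a * rho y) by (apply Rmult_le_pos; auto).
  replace (a ^ 2 * rho y ^ 2) with ((a * rho y) ^ 2) by ring.
  replace (b ^ 2 * rho x ^ 2) with ((b * rho x) ^ 2) by ring.
  apply pow_incr; lra.
Qed.

(** * Behaviour of [rho] near [x = 1] *)

(** The weight [sin t ^ 2] is at most the product of the two radicals, so the integrand of the
    difference is at most [Rad x t - Rad y t], and rationalising that gives a denominator of at
    least [2 * sqrt (1 - y)]. *)
Lemma rho_lipschitz (x y : R) : 0 <= x <= y -> y < 1 ->
  rho y - rho x <= (y - x) / sqrt (1 - y).
Proof.
  intros h hy; set (z := sqrt (1 - y)); assert (hz : 0 < z) by (apply sqrt_lt_R0; lra).
  assert (i1 := rho_integrable x ltac:(lra)); assert (i2 := rho_integrable y ltac:(lra)).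
  apply Rle_trans with (((y - x) / (2 * z)) * (PI / 2)).
  - rewrite <- integ_const.
    replace (rho y - rho x) with
      (integ (fun t => 1 * (sin t ^ 2 / Rad y t) + (- 1) * (sin t ^ 2 / Rad x t)))
      by (rewrite integ_lin by auto; unfold rho; ring).
    apply integ_le; [apply integrable_lin; auto | apply integrable_const | ].
    intros t ht; pose proof (Rad_pos_inner y t ltac:(lra) ht) as hpy.
    pose proof (Rad_anti x y t ltac:(lra)) as ha.
    pose proof (Rad_sqr x t ltac:(lra)) as hx2; pose proof (Rad_sqr y t ltac:(lra)) as hy2.
    pose proof (Rad_le y t ltac:(lra) ltac:(lra)) as hl; fold z in hl.
    pose proof (Rad_ge_sin y t ltac:(lra) ltac:(lra)) as hs.
    pose proof (sin_nonneg_quarter t ltac:(lra)) as hs0; pose proof (cos_sqr_bound t) as hc.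
    set (X := Rad x t) in *; set (Y := Rad y t) in *.
    assert (e : X - Y = (y - x) * cos t ^ 2 / (X + Y)).
    { apply Rmult_eq_reg_r with (X + Y); [ | lra]; field_simplify; [ | lra]; rewrite hx2, hy2; ring. }
    assert (X - Y <= (y - x) / (2 * z)).
    { rewrite e; apply Rmult_le_compat; [nra | left; apply Rinv_0_lt_compat; lra | nra | ].
      apply Rinv_le_contravar; lra. }
    apply Rle_trans with (X - Y); [ | auto].
    apply Rmult_le_reg_r with (X * Y); [nra | ].
    replace ((1 * (sin t ^ 2 / Y) + -1 * (sin t ^ 2 / X)) * (X * Y)) with (sin t ^ 2 * (X - Y))
      by (field; lra).
    assert (sin t ^ 2 <= X * Y) by nra; nra.
  - pose proof PI_4; unfold Rdiv; rewrite Rinv_mult.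
    assert (0 <= (y - x) * / z) by (apply Rmult_le_pos; [lra | left; apply Rinv_0_lt_compat, hz]).
    nra.
Qed.

(* [1 / Rad] is dominated by [2 * cos t / (sin t + z) + 1], whose primitive is explicit. *)
Lemma rho_gap (x : R) : 1 / 2 <= x < 1 ->
  1 - rho x <= 4 * (sqrt (1 - x) * sqrt (sqrt (1 - x))).
Proof.
  intros hx; set (z := sqrt (1 - x)).
  assert (hz : 0 < z) by (apply sqrt_lt_R0; lra).
  assert (hz2 : z ^ 2 = 1 - x) by (apply pow2_sqrt; lra).
  set (q := sqrt z); assert (hq : 0 < q) by (apply sqrt_lt_R0; lra).
  assert (hq2 : q ^ 2 = z) by (apply pow2_sqrt; lra).
  assert (z <= 1) by nra; assert (q <= 1) by nra.
  destruct (integ_derive (fun t => 2 * ln (sin t + z) + t) (fun t => 2 * cos t / (sin t + z) + 1)) as [i1 i2].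
  - intros t ht; pose proof (sin_nonneg_quarter t ht); auto_derive; [lra | field; lra].
  - intros t ht; pose proof (sin_nonneg_quarter t ht); apply continuous_of_derive.
    auto_derive; lra.
  - rewrite sin_PI2, sin_0 in i2.
    assert (hi : integ (fun t => 2 * cos t / (sin t + z) + 1) <= 8 / q).
    { rewrite i2, Rplus_0_l.
      assert (ln (1 + z) <= z).
      { rewrite <- (ln_exp z) at 2; apply ln_le; [lra | left; apply exp_ineq1; lra]. }
      (* The logarithm is traded for [/ q], with [q ^ 2 = z]. The resulting order z^(3/2) still
         makes [1 - rho x] negligible against [sqrt (1 - x)]. *)
      assert (e : ln z = - (2 * ln (/ q))).
      { rewrite ln_Rinv by lra; rewrite <- hq2; simpl; rewrite Rmult_1_r, ln_mult by lra; ring. }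
      assert (hiq : 0 < / q) by (apply Rinv_0_lt_compat; lra).
      assert (ln (/ q) <= / q).
      { rewrite <- (ln_exp (/ q)) at 2; apply ln_le; [lra | ].
        pose proof (exp_ineq1 (/ q)); lra. }
      assert (1 <= / q) by (rewrite <- Rinv_1; apply Rinv_le_contravar; lra).
      pose proof PI_4; rewrite e; lra. }
    assert (hd : 1 - rho x <= z ^ 2 / 2 * integ (fun t => 2 * cos t / (sin t + z) + 1)).
    { rewrite <- integ_scal by exact i1.
      replace (1 - rho x) with (integ (fun t => 1 * sin t + (- 1) * (sin t ^ 2 / Rad x t))).
      2:{ rewrite integ_lin; [ | apply integ_sin | apply rho_integrable; lra].
          rewrite (proj2 integ_sin); unfold rho; ring. }
      apply integ_le.
      - apply integrable_lin; [apply integ_sin | apply rho_integrable; lra].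
      - apply integrable_scal, i1.
      - intros t ht; pose proof (Rad_pos_inner x t ltac:(lra) ht) as hp.
        pose proof (Rad_sqr x t ltac:(lra)) as hR; pose proof (sin_cos_sqr t) as hsc.
        pose proof (cos_sqr_bound t) as hc2; pose proof (cos_nonneg_quarter t ltac:(lra)) as hc.
        pose proof (Rad_ge_sin x t ltac:(lra) ltac:(lra)) as hge.
        pose proof (sin_nonneg_quarter t ltac:(lra)) as hs.
        assert (hs0 : 0 < sin t) by (apply sin_gt_0; lra).
        set (S := sin t) in *; set (C := cos t) in *; set (Y := Rad x t) in *.
        assert (e1 : Y ^ 2 = S ^ 2 + z ^ 2 * C ^ 2) by (rewrite hR, hz2, hsc; ring).
        assert (hY : S + z <= 2 * Y).
        { apply Rsqr_incr_0_var; [unfold Rsqr | lra].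
          replace (2 * Y * (2 * Y)) with (4 * Y ^ 2) by ring; rewrite e1.
          assert (z ^ 2 <= 1 / 2) by lra.
          assert (C ^ 2 = 1 - S ^ 2) by lra.
          pose proof (pow2_ge_0 (S - z)); nra. }
        assert (h1 : / Y <= 2 * C / (S + z) + 1).
        { replace (/ Y) with (C * / Y + (1 - C) * / Y) by ring.
          apply Rplus_le_compat.
          - unfold Rdiv; replace (2 * C * / (S + z)) with (C * (2 * / (S + z))) by ring.
            apply Rmult_le_compat_l; [lra | ].
            replace (2 * / (S + z)) with (/ ((S + z) / 2)) by (field; lra).
            apply Rinv_le_contravar; lra.
          - apply Rmult_le_reg_r with Y; [lra | ]; rewrite Rmult_assoc, Rinv_l by lra; nra. }
        apply Rle_trans with (z ^ 2 / 2 * / Y); [ | apply Rmult_le_compat_l; nra].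
        apply Rmult_le_reg_r with Y; [lra | ].
        replace ((1 * S + -1 * (S ^ 2 / Y)) * Y) with (S * (Y - S)) by (field; lra).
        replace (z ^ 2 / 2 * / Y * Y) with (z ^ 2 / 2) by (field; lra).
        assert (S * (Y - S) * 2 <= (Y + S) * (Y - S)) by nra.
        assert (z ^ 2 * C ^ 2 <= z ^ 2) by nra; nra. }
    eapply Rle_trans; [exact hd | ].
    apply Rle_trans with (z ^ 2 / 2 * (8 / q)); [apply Rmult_le_compat_l; nra | right].
    rewrite <- hq2; field; lra.
Qed.

(** The pointwise form of [rho_near_one], with [S = sin t] and [v = sqrt (1 - x) * cos t]. The
    quadratic form is [Y ^ 2 + S * Y], for [Y ^ 2 = S ^ 2 + v ^ 2], with the second [Y] lowered to
    [(4 * S + 3 * v) / 5]. The weight, affine in [S], integrates against [cos t] to 426/1000 -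
    365/2000 = 487/2000. *)
Lemma quadrant_ineq (S v : R) : 0 <= S <= 1 -> 0 <= v -> 8 * v ^ 2 <= 1 - S ^ 2 ->
  v * S <= (426 / 1000 - 365 / 1000 * S) * (9 / 5 * S ^ 2 + 3 / 5 * S * v + v ^ 2).
Proof.
  intros hS hv hv2; set (A := 426 / 1000 - 365 / 1000 * S).
  (* Replacing [v] by its upper bound [(v ^ 2 / m + m) / 2] makes the claim affine in [v ^ 2], so it
     need only be checked at the extreme values 0 and [(1 - S ^ 2) / 8]. Each [m] used below
     approximates the largest admissible [v] at a point of its interval. *)
  assert (mid : forall m, 0 < m ->
    0 <= 9 / 5 * A * S ^ 2 - (1 - 3 / 5 * A) * S * m / 2 ->
    0 <= A * (1 / 8 + 67 / 40 * S ^ 2) - (1 - 3 / 5 * A) * S * ((1 - S ^ 2) / (8 * m) + m) / 2 ->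
    v * S <= A * (9 / 5 * S ^ 2 + 3 / 5 * S * v + v ^ 2)).
  { intros m hm h0 h1.
    assert (hA : 0 < 1 - 3 / 5 * A) by (unfold A; lra).
    assert (hvm : v <= (v ^ 2 / m + m) / 2).
    { assert (0 <= (v - m) ^ 2 / m) by (apply Rdiv_le_0_compat; [apply pow2_ge_0 | lra]).
      replace ((v - m) ^ 2 / m) with (v ^ 2 / m + m - 2 * v) in H by (field; lra); lra. }
    assert (0 <= (1 - 3 / 5 * A) * S) by (apply Rmult_le_pos; lra).
    assert ((1 - 3 / 5 * A) * S * v <= (1 - 3 / 5 * A) * S * ((v ^ 2 / m + m) / 2))
      by (apply Rmult_le_compat_l; auto).
    set (K := A - (1 - 3 / 5 * A) * S / (2 * m)).
    assert (e0 : A * v ^ 2 + 9 / 5 * A * S ^ 2 - (1 - 3 / 5 * A) * S * ((v ^ 2 / m + m) / 2) =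
      (9 / 5 * A * S ^ 2 - (1 - 3 / 5 * A) * S * m / 2) + K * v ^ 2) by (unfold K; field; lra).
    assert (e1 : A * (1 / 8 + 67 / 40 * S ^ 2) - (1 - 3 / 5 * A) * S * ((1 - S ^ 2) / (8 * m) + m) / 2 =
      (9 / 5 * A * S ^ 2 - (1 - 3 / 5 * A) * S * m / 2) + K * ((1 - S ^ 2) / 8))
      by (unfold K; field; lra).
    pose proof (pow2_ge_0 v).
    destruct (Rle_dec 0 K) as [hK | hK].
    - assert (0 <= K * v ^ 2) by (apply Rmult_le_pos; auto); nra.
    - assert (K * ((1 - S ^ 2) / 8) <= K * v ^ 2) by nra; nra. }
  destruct (Rle_dec S (33 / 100)) as [h | h].
  { assert (305 / 1000 <= A <= 1) by (unfold A; lra).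
    pose proof (pow2_ge_0 (v - 6 / 5 * S)); pose proof (pow2_ge_0 (v - 27 / 20 * S)).
    assert (0 <= S * v) by nra; nra. }
  (* Each quartic below is a nonnegative combination of the Bernstein basis of its interval. *)
  assert (bern : forall l h, l <= S <= h ->
    0 <= (S - l) ^ 4 /\ 0 <= (S - l) ^ 3 * (h - S) /\ 0 <= (S - l) ^ 2 * (h - S) ^ 2 /\
    0 <= (S - l) * (h - S) ^ 3 /\ 0 <= (h - S) ^ 4).
  { intros l u hl; assert (0 <= S - l) by lra; assert (0 <= u - S) by lra.
    repeat split; repeat apply Rmult_le_pos; try apply pow_le; lra. }
  destruct (Rle_dec S (45 / 100)).
  { pose proof (bern (33 / 100) (45 / 100) ltac:(lra)); apply (mid (316 / 1000)); unfold A; nra. }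
  destruct (Rle_dec S (60 / 100)).
  { pose proof (bern (45 / 100) (60 / 100) ltac:(lra)); apply (mid (304 / 1000)); unfold A; nra. }
  destruct (Rle_dec S (75 / 100)).
  { pose proof (bern (60 / 100) (75 / 100) ltac:(lra)); apply (mid (266 / 1000)); unfold A; nra. }
  destruct (Rle_dec S (85 / 100)).
  { pose proof (bern (75 / 100) (85 / 100) ltac:(lra)); apply (mid (234 / 1000)); unfold A; nra. }
  destruct (Rle_dec S (93 / 100)).
  { pose proof (bern (85 / 100) (93 / 100) ltac:(lra)); apply (mid (186 / 1000)); unfold A; nra. }
  pose proof (bern (93 / 100) 1 ltac:(lra)); apply (mid (130 / 1000)); unfold A; nra.
Qed.

(** Weaker in order than [rho_gap], but with a constant small enough for [fixed_curves_ordered] on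
    all of [7 / 8 <= x < 1]. *)
Lemma rho_near_one (x : R) : 7 / 8 <= x < 1 -> 1 - rho x <= 487 / 2000 * sqrt (1 - x).
Proof.
  intros hx; set (z := sqrt (1 - x)).
  assert (hz : 0 < z) by (apply sqrt_lt_R0; lra).
  assert (hz2 : z ^ 2 = 1 - x) by (apply pow2_sqrt; lra).
  replace (1 - rho x) with (integ (fun t => 1 * sin t + (- 1) * (sin t ^ 2 / Rad x t))).
  2:{ rewrite integ_lin; [ | apply integ_sin | apply rho_integrable; lra].
      rewrite (proj2 integ_sin); unfold rho; ring. }
  replace (487 / 2000 * z) with
    (integ (fun t => z * 426 / 1000 * cos t + (- z * 365 / 1000) * (sin t * cos t))).
  2:{ rewrite integ_lin; [ | apply integ_cos | apply integ_sin_cos].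
      rewrite (proj2 integ_cos), (proj2 integ_sin_cos); field. }
  apply integ_le.
  - apply integrable_lin; [apply integ_sin | apply rho_integrable; lra].
  - apply integrable_lin; [apply integ_cos | apply integ_sin_cos].
  - intros t ht; pose proof (Rad_pos_inner x t ltac:(lra) ht) as hp.
    pose proof (Rad_sqr x t ltac:(lra)) as hR; pose proof (sin_cos_sqr t) as hsc.
    pose proof (cos_nonneg_quarter t ltac:(lra)) as hc.
    pose proof (sin_nonneg_quarter t ltac:(lra)) as hs.
    set (S := sin t) in *; set (C := cos t) in *; set (Y := Rad x t) in *.
    set (v := z * C); assert (hv : 0 <= v) by (apply Rmult_le_pos; lra).
    assert (e1 : Y ^ 2 = S ^ 2 + v ^ 2) by (unfold v; rewrite Rpow_mult_distr, hR, hz2, hsc; ring).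
    assert (hv8 : 8 * v ^ 2 <= 1 - S ^ 2).
    { unfold v; rewrite Rpow_mult_distr, hz2; pose proof (pow2_ge_0 C); nra. }
    pose proof (quadrant_ineq S v hs hv hv8) as hq.
    assert (hY : (4 * S + 3 * v) / 5 <= Y).
    { apply Rsqr_incr_0_var; [unfold Rsqr | lra].
      replace (Y * Y) with (Y ^ 2) by ring; rewrite e1; pose proof (pow2_ge_0 (3 * S - 4 * v)); nra. }
    assert (hA : 0 <= 426 / 1000 - 365 / 1000 * S) by lra.
    assert (h2 : v * S <= (426 / 1000 - 365 / 1000 * S) * (Y ^ 2 + S * Y)).
    { eapply Rle_trans; [exact hq | ]; apply Rmult_le_compat_l; [exact hA | rewrite e1; nra]. }
    replace (z * 426 / 1000 * C + - z * 365 / 1000 * (S * C)) with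
      (v * (426 / 1000 - 365 / 1000 * S)) by (unfold v; field).
    destruct (Req_dec v 0) as [h0 | h0].
    { rewrite h0, Rmult_0_l.
      assert (Y = S) by (rewrite h0 in e1; apply Rsqr_inj; try lra; unfold Rsqr; nra).
      rewrite H; right; field; lra. }
    apply Rmult_le_reg_r with (Y * (Y + S)); [apply Rmult_lt_0_compat; lra | ].
    replace ((1 * S + -1 * (S ^ 2 / Y)) * (Y * (Y + S))) with (S * (Y ^ 2 - S ^ 2)) by (field; lra).
    rewrite e1; nra.
Qed.

Lemma PI_lower : 31415 / 10000 <= PI.
Proof.
  pose proof (proj1 (PI_2_3_7_ineq 2)) as h.
  unfold PI_2_3_7_tg, tg_alt, Ratan_seq in h; simpl in h; lra.
Qed.

Lemma PI_upper : PI <= 31416 / 10000.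
Proof.
  pose proof (proj2 (PI_2_3_7_ineq 3)) as h.
  unfold PI_2_3_7_tg, tg_alt, Ratan_seq in h; simpl in h; lra.
Qed.

(** * One noiseless step *)

(* [mcrit / (1 - mcrit)] is [4 / delta_AMP]. *)
Definition mcrit : R := (PI / 4) ^ 2.

Lemma mcrit_bounds : 6168 / 10000 <= mcrit <= 6169 / 10000.
Proof. unfold mcrit; pose proof PI_lower; pose proof PI_upper; nra. Qed.

(** Allows a lower bound [r0] to stand in for [rho x] although [K] may be negative: after division
    by [r ^ 2], the gain has the sign of [r + r0 - h * (r * r0)]. *)
Lemma diag_mono (K m h r0 r : R) : 0 <= m -> h <= 2 -> 0 < r0 <= r -> r <= 1 ->
  0 <= K * r0 ^ 2 + m * (r0 * h) - m -> 0 <= K * r ^ 2 + m * (r * h) - m.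
Proof.
  intros hm hh h0 h1 hp.
  apply Rmult_le_reg_r with (r0 ^ 2); [apply pow_lt; lra | rewrite Rmult_0_l].
  assert (e : (K * r ^ 2 + m * (r * h) - m) * r0 ^ 2 =
    r ^ 2 * (K * r0 ^ 2 + m * (r0 * h) - m) + m * ((r - r0) * (r + r0 - h * (r * r0)))) by ring.
  rewrite e; apply Rplus_le_le_0_compat; [apply Rmult_le_pos; auto; apply pow2_ge_0 | ].
  assert (0 < r * r0) by nra.
  apply Rmult_le_pos; auto; apply Rmult_le_pos; nra.
Qed.

(* The fixed-point curve of the first component lies above that of the second one. *)
Lemma fixed_curves_ordered (x : R) : 0 <= x <= 1 ->
  mcrit * (rho x ^ 2 + 1 - rho x * ell x) <= (1 - mcrit) * ((1 - x) * rho x ^ 2).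
Proof.
  intros hx; pose proof mcrit_bounds as hm; set (m := mcrit) in *.
  pose proof (rho_le_one x ltac:(lra)) as hr1.
  cut (0 <= ((1 - m) * (1 - x) - m) * rho x ^ 2 + m * (rho x * ell x) - m);
    [intros; lra | ].
  pose proof (ell_le_two x hx) as hl2.
  (* Equality holds at 0 and at 1: the Taylor bounds, exact at 0, serve up to 7/8, and bounds exact
     at 1 serve beyond. *)
  destruct (Rle_dec x (7 / 8)) as [h | h].
  - set (p := PI / 4); assert (hp : 785 / 1000 <= p) by (unfold p; pose proof PI_lower; lra).
    assert (em : m = p ^ 2) by reflexivity.
    pose proof (rho_ge_poly x hx) as hr; pose proof (ell_ge_poly x ltac:(lra)) as hl; fold p in hr, hl.
    assert (hs : 1 <= rho_poly x).
    { unfold rho_poly; pose proof (pow_le x 2 ltac:(lra)); pose proof (pow_le x 3 ltac:(lra));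
      pose proof (pow_le x 4 ltac:(lra)); lra. }
    assert (0 < p * rho_poly x) by (apply Rmult_lt_0_compat; lra).
    apply diag_mono with (p * rho_poly x); [lra.. | ].
    (* As [m = p ^ 2], a factor [p ^ 2] comes out, and the remaining [m] has a nonnegative
       coefficient ([hB]), so a decimal lower bound can replace it. *)
    apply Rle_trans with (p ^ 2 * (((1 - x) * rho_poly x ^ 2 - 1) +
      m * (rho_poly x * (ell_poly x - (2 - x) * rho_poly x)))).
    2:{ assert (p * rho_poly x * (p * ell_poly x) <= p * rho_poly x * ell x)
          by (apply Rmult_le_compat_l; lra).
        rewrite em in *; nra. }
    apply Rmult_le_pos; [apply pow2_ge_0 | ].
    assert (hB : 0 <= rho_poly x * (ell_poly x - (2 - x) * rho_poly x)).
    { apply Rmult_le_pos; [lra | unfold ell_poly, rho_poly].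
      replace (2 + x / 2 + x ^ 2 / 32 + x ^ 3 / 128 - (2 - x) *
          (1 + x / 8 + 3 * x ^ 2 / 64 + 25 * x ^ 3 / 1024 + 245 * x ^ 4 / 16384))
        with (x * (5 / 4 + x * (1 / 32 + 1 / 8 - 3 / 32) + x ^ 2 * (1 / 128 + 3 / 64 - 50 / 1024)
          + x ^ 3 * (25 / 1024 - 490 / 16384) + 245 * x ^ 4 / 16384)) by field.
      assert (x ^ 3 <= 1) by (rewrite <- (pow1 3); apply pow_incr; lra).
      pose proof (pow_le x 2 ltac:(lra)); pose proof (pow_le x 4 ltac:(lra)).
      apply Rmult_le_pos; lra. }
    apply Rle_trans with (((1 - x) * rho_poly x ^ 2 - 1) +
      6168 / 10000 * (rho_poly x * (ell_poly x - (2 - x) * rho_poly x)));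
      [ | apply Rplus_le_compat_l, Rmult_le_compat_r; lra].
    assert (pw : forall k, 0 <= x ^ k <= (7 / 8) ^ k)
      by (intros k; split; [apply pow_le; lra | apply pow_incr; lra]).
    (* The constant term cancels. Inside the bracket only the first coefficient is positive, so
       bounding every power by its value at 7/8 is enough. *)
    apply Rle_trans with (x * (21 / 1000 - 57 / 10000 * x ^ 1 - 2723 / 640000 * x ^ 2
      - 9513 / 2048000 * x ^ 3 - 109989 / 10240000 * x ^ 4 - 310703 / 131072000 * x ^ 5
      - 56631 / 65536000 * x ^ 6 - 1114113 / 3355443200 * x ^ 7 - 1150079 / 13421772800 * x ^ 8)).
    + apply Rmult_le_pos; [lra | ].
      pose proof (pw 1%nat); pose proof (pw 2%nat); pose proof (pw 3%nat); pose proof (pw 4%nat);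
      pose proof (pw 5%nat); pose proof (pw 6%nat); pose proof (pw 7%nat); pose proof (pw 8%nat); lra.
    + right; unfold ell_poly, rho_poly; field.
  - destruct (Req_dec x 1) as [-> | hn]; [rewrite rho_one, ell_one; lra | ].
    set (z := sqrt (1 - x)).
    assert (hz : 0 < z) by (apply sqrt_lt_R0; lra).
    assert (hz2 : z ^ 2 = 1 - x) by (apply pow2_sqrt; lra).
    pose proof (rho_near_one x ltac:(lra)) as hr; fold z in hr.
    pose proof (ell_ge_near_one x hx) as hl.
    set (r0 := 1 - 487 / 2000 * z) in *.
    assert (hz3 : z <= 3536 / 10000) by nra.
    assert (hr0 : 9138 / 10000 <= r0 <= 1) by (unfold r0; lra).
    apply diag_mono with r0; try lra; [unfold r0; lra | ].
    rewrite <- hz2 in *.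
    (* [(1 - r0) ^ 2] is a multiple of [z ^ 2], which makes the whole expression divisible by
       [z ^ 2 = 1 - x]. *)
    apply Rle_trans with (z ^ 2 * ((1 - m) * r0 ^ 2 - m * ((487 / 2000) ^ 2 + r0 / 2))).
    2:{ assert (r0 * (2 - z ^ 2 / 2) <= r0 * ell x) by (apply Rmult_le_compat_l; lra).
        assert (e : (1 - r0) ^ 2 = z ^ 2 * (487 / 2000) ^ 2) by (unfold r0; ring).
        nra. }
    apply Rmult_le_pos; [apply pow2_ge_0 | nra].
Qed.

(** The bracket of psi_2 with [A] for |alpha|^2 and [s] for sigma^2; see [psi2_gap]. *)
Definition gap_fun (A s : R) : R := A + s + 1 - sqrt (A + s) * ell (A / (A + s)).

Lemma quadratic_gap_nonneg (r x : R) : 0 <= x <= 1 -> 0 <= r -> 0 <= r ^ 2 + 1 - r * ell x.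
Proof.
  intros hx hr; pose proof (ell_le_two x hx); pose proof (pow2_ge_0 (r - 1)); nra.
Qed.

Lemma concave_between (K B m u0 u u1 : R) : 0 <= m -> u0 <= u <= u1 ->
  0 <= K + B * u0 - m * u0 ^ 2 -> 0 <= K + B * u1 - m * u1 ^ 2 -> 0 <= K + B * u - m * u ^ 2.
Proof.
  intros hm hu h0 h1; destruct (Req_dec u0 u1) as [e | hn].
  - replace u with u0 by lra; auto.
  - apply Rmult_le_reg_r with (u1 - u0); [lra | rewrite Rmult_0_l].
    replace ((K + B * u - m * u ^ 2) * (u1 - u0)) with
      ((u1 - u) * (K + B * u0 - m * u0 ^ 2) + (u - u0) * (K + B * u1 - m * u1 ^ 2) +
       m * ((u - u0) * (u1 - u) * (u1 - u0))) by ring.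
    repeat apply Rplus_le_le_0_compat; repeat apply Rmult_le_pos; lra.
Qed.

Lemma ratio_unit (A s : R) : 0 < A -> 0 <= s -> 0 < A / (A + s) <= 1.
Proof.
  intros hA hs; split; [apply Rdiv_lt_0_compat; lra | ].
  apply Rle_div_l; lra.
Qed.

(** Divided by [A + s], the claim is a concave quadratic in [u = / sqrt (A + s)]. Since [s] lies
    above the curve, [u <= / rho x], and at that endpoint the claim is [fixed_curves_ordered]; the
    lower endpoint is explicit. *)
Lemma gap_above (xi A s : R) : 0 < xi <= 1 -> 0 < A <= 1 -> A = xi * rho xi ^ 2 ->
  (1 - xi) * rho xi ^ 2 <= s -> s <= mcrit / (1 - mcrit) ->
  mcrit * gap_fun A s <= (1 - mcrit) * s.
Proof.
  intros hxi hA eA hs hs1; pose proof mcrit_bounds as hm; set (m := mcrit) in *.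
  assert (hs0 : 0 <= s) by (pose proof (pow2_ge_0 (rho xi)); nra).
  unfold gap_fun; pose proof (ratio_unit A s ltac:(lra) hs0) as hx.
  set (x := A / (A + s)) in *.
  set (r := sqrt (A + s)); assert (hr : 0 < r) by (apply sqrt_lt_R0; lra).
  assert (hr2 : r ^ 2 = A + s) by (apply pow2_sqrt; lra).
  assert (ex : x * r ^ 2 = A) by (unfold x; rewrite hr2; field; lra).
  assert (hxx : x <= xi).
  { apply Rmult_le_reg_r with (r ^ 2); [apply pow_lt, hr | ]; rewrite ex, hr2; nra. }
  assert (hrr : rho x <= r).
  { apply Rle_trans with (rho xi); [apply rho_incr; lra | ].
    apply Rsqr_incr_0_var; [unfold Rsqr; nra | lra]. }
  assert (hrx : 0 < rho x).
  { pose proof (rho_ge_poly 0 ltac:(lra)) as h0; pose proof (rho_incr 0 x ltac:(lra) ltac:(lra)).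
    unfold rho_poly in h0; pose proof PI_lower; lra. }
  set (u := / r); assert (hu : 0 < u) by (apply Rinv_0_lt_compat, hr).
  assert (eu : u * r = 1) by (unfold u; field; lra).
  set (K := (1 - m) * (1 - x) - m).
  cut (0 <= K + m * ell x * u - m * u ^ 2).
  { intros h; apply (Rmult_le_compat_r (r ^ 2)) in h; [ | apply pow2_ge_0].
    replace ((K + m * ell x * u - m * u ^ 2) * r ^ 2) with
      (K * r ^ 2 + m * ell x * r * (u * r) - m * (u * r) ^ 2) in h by ring.
    rewrite eu in h; unfold K in h.
    replace (((1 - m) * (1 - x) - m) * r ^ 2) with ((1 - m) * (r ^ 2 - x * r ^ 2) - m * r ^ 2) in h by ring.
    rewrite ex, hr2 in h; lra. }
  assert (hi : 0 <= K + m * ell x * / rho x - m * (/ rho x) ^ 2).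
  { pose proof (fixed_curves_ordered x ltac:(lra)) as hd; fold m in hd.
    apply Rmult_le_reg_r with (rho x ^ 2); [apply pow_lt, hrx | ]; unfold K.
    field_simplify; [ | lra]; lra. }
  assert (hiu : u <= / rho x) by (apply Rinv_le_contravar; lra).
  assert (hux : x <= u ^ 2).
  { apply Rmult_le_reg_r with (r ^ 2); [apply pow_lt, hr | ].
    replace (u ^ 2 * r ^ 2) with ((u * r) ^ 2) by ring; rewrite eu, ex; lra. }
  assert (hum : 1 - m <= u ^ 2).
  { apply Rmult_le_reg_r with (r ^ 2); [apply pow_lt, hr | ].
    replace (u ^ 2 * r ^ 2) with ((u * r) ^ 2) by ring; rewrite eu, hr2.
    apply (Rmult_le_compat_l (1 - m)) in hs1; [ | lra].
    replace ((1 - m) * (m / (1 - m))) with m in hs1 by (field; lra); nra. }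
  (* Two lower bounds for [u] are available: sqrt(1 - m), slightly above 0.616, from the bound on
     [s], and [sqrt x] from [A <= 1]. They cross at [x = 1 - m], about 0.38. *)
  destruct (Rle_dec x (38 / 100)) as [h | h].
  - apply concave_between with (616 / 1000) (/ rho x); auto; [lra | split; auto; nra | ].
    pose proof (ell_ge_tangent_zero x ltac:(lra)); pose proof PI_lower.
    assert (157 / 100 + 392 / 1000 * x <= ell x) by nra; unfold K; nra.
  - set (w := sqrt x); assert (hw2 : w ^ 2 = x) by (apply pow2_sqrt; lra).
    assert (hw : 0 < w) by (apply sqrt_lt_R0; lra).
    apply concave_between with w (/ rho x); auto; [lra | split; auto | ].
    { apply Rsqr_incr_0_var; [unfold Rsqr; nra | lra]. }
    pose proof (ell_ge_near_one x ltac:(lra)) as hl.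
    assert (hw1 : 616 / 1000 <= w <= 1) by nra.
    assert (m * w * (2 - (1 - x) / 2) <= m * w * ell x) by (apply Rmult_le_compat_l; nra).
    assert (e : K + m * w * (2 - (1 - x) / 2) - m * w ^ 2 =
      (1 - w) * ((1 - m) * (1 + w) - m * (1 - w / 2 + w ^ 2 / 2))) by (unfold K; rewrite <- hw2; field).
    assert (0 <= (1 - w) * ((1 - m) * (1 + w) - m * (1 - w / 2 + w ^ 2 / 2)))
      by (apply Rmult_le_pos; nra).
    nra.
Qed.

(* [r ^ 2 + 1 - al * r - be * A / r] bounds [gap_fun] from above when [al + be * x] is a tangent line
   of [ell]; its square times [s = r ^ 2 - A] is nondecreasing in [r] although it is not itself
   monotone. *)
Lemma weighted_gap_mono (al be A r r0 : R) :
  0 <= al -> 0 <= be -> PI / 4 <= 2 * be ->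
  (forall x, 0 <= x <= 1 -> al + be * x <= ell x) ->
  0 < A -> 0 < r <= r0 -> A <= r ^ 2 ->
  (r ^ 2 - A) * (r ^ 2 + 1 - al * r - be * A / r) ^ 2 <=
  (r0 ^ 2 - A) * (r0 ^ 2 + 1 - al * r0 - be * A / r0) ^ 2.
Proof.
  intros hal hbe hb2 htan hA hr hAr.
  set (q := fun v => v ^ 2 + 1 - al * v - be * A / v).
  set (dq := fun v => 2 * v - al + be * A / v ^ 2).
  set (dN := fun v => 2 * q v * (v * q v + (v ^ 2 - A) * dq v)).
  assert (hN : forall v, 0 < v -> is_derive (fun w => (w ^ 2 - A) * q w ^ 2) v (dN v)).
  { intros v hv; unfold q, dN, dq; auto_derive; [lra | unfold q; field; lra]. }
  destruct (MVT_gen (fun w => (w ^ 2 - A) * q w ^ 2) r r0 dN) as [v [hv e]].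
  - intros v; rewrite Rmin_left, Rmax_right by lra; intros; apply hN; lra.
  - intros v; rewrite Rmin_left, Rmax_right by lra; intros hv.
    apply continuity_pt_filterlim, (continuous_of_derive (fun w => (w ^ 2 - A) * q w ^ 2)).
    eexists; apply hN; lra.
  - rewrite Rmin_left, Rmax_right in hv by lra.
    cut (0 <= dN v).
    { intros h; assert (0 <= dN v * (r0 - r)) by (apply Rmult_le_pos; lra); unfold q in e; lra. }
    set (x := A / v ^ 2).
    assert (hv2 : r ^ 2 <= v ^ 2) by (apply pow_incr; lra).
    assert (hvp : 0 < v ^ 2) by (apply pow_lt; lra).
    assert (hx : 0 <= x <= 1).
    { split; [apply Rdiv_le_0_compat; lra | apply Rle_div_l; lra]. }
    assert (eA : A = x * v ^ 2) by (unfold x; field; lra).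
    assert (hq : 0 <= q v).
    { pose proof (quadratic_gap_nonneg v x hx ltac:(lra)); pose proof (htan x hx) as ht.
      replace (q v) with (v ^ 2 + 1 - v * (al + be * x)) by (unfold q; rewrite eA; field; lra).
      assert (v * (al + be * x) <= v * ell x) by (apply Rmult_le_compat_l; lra); lra. }
    (* The sign of [dN v] is that of [1 + (3 - 2 * x) * v ^ 2 - M * v], so a discriminant bound
       suffices. It is tight at [x = 1] if [M = 2] there, which is why [M] is estimated in powers of
       [1 - x]. *)
    set (M := (al + be * x) * (2 - x) - 2 * be * x * (1 - x)).
    assert (eD : v * q v + (v ^ 2 - A) * dq v = v * (1 + (3 - 2 * x) * v ^ 2 - M * v)).
    { unfold q, dq, M; rewrite eA; field; lra. }
    assert (hM0 : 0 <= M).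
    { replace M with (al * (2 - x) + be * x ^ 2) by (unfold M; ring).
      pose proof (pow2_ge_0 x); apply Rplus_le_le_0_compat; apply Rmult_le_pos; lra. }
    assert (hM : M <= 2 + (1 - x) * (7855 / 10000 + 3565 / 10000 * (1 - x))).
    { pose proof (htan x hx); pose proof (ell_le_chord x hx).
      assert ((al + be * x) * (2 - x) <= ((1 - x) * (PI / 2) + x * 2) * (2 - x))
        by (apply Rmult_le_compat_r; lra).
      assert (PI / 4 * (x * (1 - x)) <= 2 * be * (x * (1 - x)))
        by (apply Rmult_le_compat_r; [apply Rmult_le_pos | ]; lra).
      pose proof PI_upper; pose proof PI_lower; unfold M.
      apply Rle_trans with (((1 - x) * (PI / 2) + x * 2) * (2 - x) - PI / 4 * (x * (1 - x))); [lra | ].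
      replace (((1 - x) * (PI / 2) + x * 2) * (2 - x) - PI / 4 * (x * (1 - x))) with
        (2 + (1 - x) * (PI / 4 + (1 - x) * (3 * (PI / 4) - 2))) by field.
      apply Rplus_le_compat_l, Rmult_le_compat_l; [lra | apply Rplus_le_compat; [lra | nra]]. }
    assert (hdisc : M ^ 2 <= 4 * (3 - 2 * x)).
    { set (y := 1 - x) in *.
      apply Rle_trans with ((2 + y * (7855 / 10000 + 3565 / 10000 * y)) ^ 2).
      - apply pow_incr; lra.
      - replace (3 - 2 * x) with (1 + 2 * y) by (unfold y; ring).
        assert (hy : 0 <= y <= 1) by (unfold y; lra); clearbody y; nra. }
    unfold dN; rewrite eD.
    apply Rmult_le_pos; [lra | apply Rmult_le_pos; [lra | ]].
    pose proof (pow2_ge_0 (2 * (3 - 2 * x) * v - M)); nra.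
Qed.

(** Replacing [ell] by its tangent at [xi] changes nothing on the curve itself, where [r = R0] and
    [fixed_curves_ordered] applies. The bound [q] so obtained is largest at [R0] among the [r] in
    [PI / 4, R0]; a smaller [r] is handled by the weighted monotonicity, at the price of a factor
    [th]. *)
Lemma gap_below (th xi A s : R) : 0 < th < 1 -> 0 < xi < 1 -> A = xi * rho xi ^ 2 ->
  0 < s -> th ^ 2 * (mcrit * (1 - xi)) <= s -> s <= (1 - xi) * rho xi ^ 2 ->
  th * mcrit * gap_fun A s <= (1 - mcrit) * ((1 - xi) * rho xi ^ 2).
Proof.
  intros hth hxi eA hs hlow hs1; pose proof mcrit_bounds as hm.
  set (R0 := rho xi) in *; set (al := ell xi - xi * R0 / 2); set (be := R0 / 2).
  assert (hR : PI / 4 <= R0).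
  { pose proof (rho_ge_poly 0 ltac:(lra)) as h0; pose proof (rho_incr 0 xi ltac:(lra) ltac:(lra)).
    unfold rho_poly in h0; fold R0 in H; lra. }
  pose proof PI_lower; pose proof (rho_le_one xi ltac:(lra)) as hR1; fold R0 in hR1.
  assert (hA : 0 < A) by (rewrite eA; apply Rmult_lt_0_compat; [ | apply pow_lt]; lra).
  assert (hell : PI / 2 <= ell xi) by (pose proof (ell_ge_tangent_zero xi ltac:(lra)); nra).
  assert (htan : forall x, 0 <= x <= 1 -> al + be * x <= ell x).
  { intros x hx; pose proof (ell_ge_tangent xi x ltac:(lra) hx) as h; fold R0 in h; unfold al, be; lra. }
  set (q := fun v => v ^ 2 + 1 - al * v - be * A / v).
  assert (hq : forall v, PI / 4 <= v <= R0 -> q v <= q R0).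
  { intros v hv.
    assert (e : q R0 - q v = (R0 - v) * (R0 + v - ell xi + xi * R0 / 2 + xi * R0 / 2 * (R0 / v)))
      by (unfold q, al, be; rewrite eA; field; lra).
    assert (hb : ell xi <= PI / 2 + xi * R0 / 2).
    { pose proof (ell_bounds 0 xi ltac:(lra) ltac:(lra)) as h; rewrite ell_zero in h; fold R0 in h; lra. }
    assert (0 <= xi * R0 / 2 * (R0 / v)).
    { apply Rmult_le_pos; [nra | apply Rdiv_le_0_compat; lra]. }
    assert (0 <= (R0 - v) * (R0 + v - ell xi + xi * R0 / 2 + xi * R0 / 2 * (R0 / v)))
      by (apply Rmult_le_pos; lra).
    lra. }
  assert (hqR : mcrit * q R0 <= (1 - mcrit) * ((1 - xi) * R0 ^ 2)).
  { pose proof (fixed_curves_ordered xi ltac:(lra)) as h; fold R0 in h.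
    replace (q R0) with (R0 ^ 2 + 1 - R0 * ell xi); [exact h | ].
    unfold q, al, be; rewrite eA; field; lra. }
  set (r := sqrt (A + s)); assert (hr : 0 < r) by (apply sqrt_lt_R0; lra).
  assert (hr2 : r ^ 2 = A + s) by (apply pow2_sqrt; lra).
  assert (hrR : r <= R0) by (apply Rsqr_incr_0_var; unfold Rsqr; nra).
  assert (hgq : 0 <= gap_fun A s <= q r).
  { unfold gap_fun; fold r; pose proof (ratio_unit A s hA ltac:(lra)) as hx.
    rewrite <- hr2; rewrite <- hr2 in hx; pose proof (htan (A / r ^ 2) ltac:(lra)) as ht.
    split; [apply quadratic_gap_nonneg; lra | unfold q].
    replace (be * A / r) with (r * (be * (A / r ^ 2))) by (field; lra).
    assert (r * (al + be * (A / r ^ 2)) <= r * ell (A / r ^ 2)) by (apply Rmult_le_compat_l; lra).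
    lra. }
  assert (hgoal : th * q r <= q R0).
  2:{ apply Rle_trans with (mcrit * (th * q r)).
      - replace (th * mcrit * gap_fun A s) with (mcrit * (th * gap_fun A s)) by ring.
        apply Rmult_le_compat_l; [lra | apply Rmult_le_compat_l; lra].
      - eapply Rle_trans; [ | exact hqR]; apply Rmult_le_compat_l; lra. }
  destruct (Rle_dec (PI / 4) r) as [h | h].
  { pose proof (hq r (conj h hrR)); nra. }
  (* With this [s0], [r0 ^ 2] is the convex combination of [R0 ^ 2] and [(PI / 4) ^ 2] with weights
     [xi] and [1 - xi], so [r0] lies in the good range; and [th ^ 2 * s0 <= s] is the assumed lower
     bound. *)
  set (s0 := mcrit * (1 - xi)); set (r0 := sqrt (A + s0)).
  assert (hs0 : 0 < s0) by (apply Rmult_lt_0_compat; lra).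
  assert (hr0 : 0 < r0) by (apply sqrt_lt_R0; lra).
  assert (hr02 : r0 ^ 2 = A + s0) by (apply pow2_sqrt; lra).
  assert (hp2 : (PI / 4) ^ 2 <= R0 ^ 2) by (apply pow_incr; lra).
  assert (hr0b : PI / 4 <= r0 <= R0).
  { unfold s0, mcrit in hr02; split; apply Rsqr_incr_0_var; unfold Rsqr; try lra; nra. }
  pose proof (weighted_gap_mono al be A r r0 ltac:(unfold al; nra) ltac:(unfold be; lra)
    ltac:(unfold be; lra) htan hA ltac:(lra) ltac:(lra)) as hw.
  fold (q r) (q r0) in hw; rewrite hr2, hr02 in hw.
  pose proof (hq r0 hr0b) as hq0.
  assert (hqr0 : 0 <= q r0).
  { unfold q; replace (be * A / r0) with (r0 * (be * (A / r0 ^ 2))) by (field; lra).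
    assert (hx : 0 <= A / r0 ^ 2 <= 1).
    { rewrite hr02; pose proof (ratio_unit A s0 hA ltac:(lra)); lra. }
    pose proof (quadratic_gap_nonneg r0 _ hx ltac:(lra)); pose proof (htan _ hx).
    assert (r0 * (al + be * (A / r0 ^ 2)) <= r0 * ell (A / r0 ^ 2)) by (apply Rmult_le_compat_l; lra).
    lra. }
  apply Rle_trans with (q r0); [ | exact hq0].
  apply Rsqr_incr_0_var; [unfold Rsqr | exact hqr0].
  apply Rmult_le_reg_l with s0; [exact hs0 | ].
  apply Rle_trans with (s * q r ^ 2); [ | lra].
  replace (s0 * (th * q r * (th * q r))) with (th ^ 2 * s0 * q r ^ 2) by ring.
  apply Rmult_le_compat_r; [apply pow2_ge_0 | exact hlow].
Qed.

(** Completing the square in [sqrt (A + s)] leaves a bound in the ratio alone, the same quantity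
    that determines the next [a]. *)
Lemma gap_lower (xi A s : R) : 0 <= s -> 0 < A -> gap_fun A s >= 1 - ell (A / (A + s)) ^ 2 / 4.
Proof.
  intros hs hA; unfold gap_fun; assert (hr2 : sqrt (A + s) ^ 2 = A + s) by (apply pow2_sqrt; lra).
  pose proof (pow2_ge_0 (sqrt (A + s) - ell (A / (A + s)) / 2)); nra.
Qed.

(** Convexity puts [ell x / 2] below the chord [l], and [1 - l ^ 2] factors as
    [(1 - p) * (1 - x) * (1 + l)] with [p <= l]. *)
Lemma ell_gap_lower (x : R) : 0 <= x <= 1 -> (1 - mcrit) * (1 - x) <= 1 - ell x ^ 2 / 4.
Proof.
  intros hx; pose proof (ell_le_chord x hx) as h; pose proof PI_lower; pose proof PI_upper.
  pose proof (ell_ge_tangent_zero x hx).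
  assert (0 <= ell x) by nra.
  set (p := PI / 4); set (l := p * (1 - x) + x).
  assert (hl : ell x / 2 <= l) by (unfold l, p; lra).
  assert (p <= l) by (unfold l, p; nra).
  assert (ell x ^ 2 / 4 <= l ^ 2).
  { replace (ell x ^ 2 / 4) with ((ell x / 2) ^ 2) by field; apply pow_incr; lra. }
  unfold mcrit; fold p.
  assert (0 <= (1 - p) * (1 - x)) by (unfold p; apply Rmult_le_pos; lra).
  assert ((1 - p) * (1 - x) * (1 + p) <= (1 - p) * (1 - x) * (1 + l)) by (apply Rmult_le_compat_l; lra).
  assert ((1 - p) * (1 - x) * (1 + l) = 1 - l ^ 2) by (unfold l; ring).
  nra.
Qed.

(* One step of the noiseless recursion, in terms of the parameter [xi] of the previous state. *)
Lemma gap_contraction (th xi A s : R) : 0 < th < 1 -> 0 < xi <= 1 -> A = xi * rho xi ^ 2 ->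
  0 <= s <= mcrit / (1 - mcrit) ->
  th ^ 2 * (mcrit / (1 - mcrit)) * (1 - ell xi ^ 2 / 4) <= s ->
  th ^ 2 * (mcrit / (1 - mcrit)) * gap_fun A s <= th * Rmax s ((1 - xi) * rho xi ^ 2).
Proof.
  intros hth hxi eA hs hlow; pose proof mcrit_bounds as hm.
  assert (hR : 785 / 1000 <= rho xi <= 1).
  { pose proof (rho_ge_poly 0 ltac:(lra)) as h0; pose proof (rho_incr 0 xi ltac:(lra) ltac:(lra)).
    unfold rho_poly in h0; pose proof PI_lower; pose proof (rho_le_one xi ltac:(lra)); lra. }
  assert (hA : 0 < A <= 1).
  { rewrite eA; split; [apply Rmult_lt_0_compat; [ | apply pow_lt]; lra | nra]. }
  assert (hc : 0 < mcrit / (1 - mcrit)) by (apply Rdiv_lt_0_compat; lra).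
  assert (fold_c : forall g v, mcrit * g <= (1 - mcrit) * v -> mcrit / (1 - mcrit) * g <= v).
  { intros g v h; apply Rmult_le_reg_l with (1 - mcrit); [lra | ].
    replace ((1 - mcrit) * (mcrit / (1 - mcrit) * g)) with (mcrit * g) by (field; lra); auto. }
  set (W := (1 - xi) * rho xi ^ 2) in *.
  (* One of the two factors [th] survives in the conclusion. The other is thrown away above the
     curve and spent in [gap_below] under it. *)
  destruct (Rle_dec W s) as [h | h].
  - rewrite Rmax_left by auto.
    pose proof (fold_c _ _ (gap_above xi A s hxi hA eA h (proj2 hs))) as hg.
    replace (th ^ 2 * (mcrit / (1 - mcrit)) * gap_fun A s) with
      (th * (th * (mcrit / (1 - mcrit) * gap_fun A s))) by ring.
    apply Rmult_le_compat_l; [lra | ].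
    assert (0 <= s * (1 - th)) by (apply Rmult_le_pos; lra).
    apply Rle_trans with (th * s); [apply Rmult_le_compat_l; lra | lra].
  - rewrite Rmax_right by lra.
    assert (hxi1 : xi < 1).
    { destruct (Req_dec xi 1) as [e | ]; [ | lra]; exfalso; apply h; unfold W; rewrite e; lra. }
    pose proof (ell_gap_lower xi ltac:(lra)) as hg.
    assert (hlow' : th ^ 2 * (mcrit * (1 - xi)) <= s).
    { eapply Rle_trans; [ | exact hlow].
      replace (th ^ 2 * (mcrit * (1 - xi))) with
        (th ^ 2 * (mcrit / (1 - mcrit)) * ((1 - mcrit) * (1 - xi))) by (field; lra).
      apply Rmult_le_compat_l; [apply Rmult_le_pos; [apply pow2_ge_0 | lra] | exact hg]. }
    assert (0 < th ^ 2 * (mcrit * (1 - xi)))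
      by (apply Rmult_lt_0_compat; [apply pow_lt | apply Rmult_lt_0_compat]; lra).
    pose proof (gap_below th xi A s hth ltac:(lra) eA ltac:(lra) hlow' ltac:(unfold W in h; lra)) as hb.
    fold W in hb; rewrite (Rmult_comm th), Rmult_assoc in hb; apply fold_c in hb.
    replace (th ^ 2 * (mcrit / (1 - mcrit)) * gap_fun A s) with
      (th * (mcrit / (1 - mcrit) * (th * gap_fun A s))) by ring.
    apply Rmult_le_compat_l; lra.
Qed.

(** * Global convergence *)

Lemma rho_zero : rho 0 = PI / 4.
Proof.
  pose proof wallis_even as [w0 [w2 _]].
  transitivity (1 * wallis 0 + (- 1) * wallis 2); [ | rewrite w0, w2; lra].
  unfold wallis; rewrite <- integ_lin by apply integrable_cos_pow.
  apply integ_ext; intros t _; rewrite Rad_zero, sin_cos_sqr; simpl; field.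
Qed.

Lemma rho_bounds (x : R) : 0 <= x <= 1 -> PI / 4 <= rho x <= 1.
Proof.
  intros hx; rewrite <- rho_zero; split; [apply rho_incr | apply rho_le_one]; lra.
Qed.

Definition phi (y : R) : R := sqrt (/ (1 + y)) * rho (/ (1 + y)).

Lemma inv_succ_bounds (y : R) : 0 <= y -> 0 < / (1 + y) <= 1.
Proof.
  intros hy; split; [apply Rinv_0_lt_compat; lra | ].
  rewrite <- Rinv_1; apply Rinv_le_contravar; lra.
Qed.

Lemma phi_sqr (y : R) : 0 <= y -> phi y ^ 2 = / (1 + y) * rho (/ (1 + y)) ^ 2.
Proof.
  intros hy; unfold phi; rewrite Rpow_mult_distr, pow2_sqrt; [reflexivity | ].
  pose proof (inv_succ_bounds y hy); lra.
Qed.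

Lemma phi_bounds (y : R) : 0 <= y -> 0 < phi y <= 1.
Proof.
  intros hy; pose proof (inv_succ_bounds y hy) as hx.
  pose proof (rho_bounds (/ (1 + y)) ltac:(lra)) as hr; pose proof PI_lower.
  assert (0 < sqrt (/ (1 + y)) <= 1).
  { split; [apply sqrt_lt_R0; lra | ].
    apply Rle_trans with (sqrt 1); [apply sqrt_le_1_alt; lra | rewrite sqrt_1; lra]. }
  unfold phi; split; [apply Rmult_lt_0_compat; lra | nra].
Qed.

Lemma phi_anti (y y' : R) : 0 <= y <= y' -> phi y' <= phi y.
Proof.
  intros h; pose proof (inv_succ_bounds y ltac:(lra)) as hx.
  pose proof (inv_succ_bounds y' ltac:(lra)) as hx'; pose proof PI_lower.
  pose proof (rho_bounds (/ (1 + y')) ltac:(lra)) as hr.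
  assert (/ (1 + y') <= / (1 + y)) by (apply Rinv_le_contravar; lra).
  apply Rmult_le_compat; [apply sqrt_pos | lra | apply sqrt_le_1_alt; lra | apply rho_incr; lra].
Qed.

(* In the coordinates [y = s / a^2], the curve on which the first component is fixed is
   [s = barrier y], [a = phi y]. *)
Definition barrier (y : R) : R := y * phi y ^ 2.

Lemma barrier_eq (y : R) : 0 <= y -> barrier y = (1 - / (1 + y)) * rho (/ (1 + y)) ^ 2.
Proof. intros hy; unfold barrier; rewrite phi_sqr by auto; field; lra. Qed.

Lemma barrier_incr (y y' : R) : 0 <= y <= y' -> barrier y <= barrier y'.
Proof.
  intros h; rewrite !barrier_eq by lra.
  pose proof (inv_succ_bounds y' ltac:(lra)); pose proof (inv_succ_bounds y ltac:(lra)).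
  apply rho_weighted_anti; [split | ]; try lra; apply Rinv_le_contravar; lra.
Qed.

Lemma barrier_le (y : R) : 0 <= y -> barrier y <= mcrit.
Proof.
  intros hy; rewrite barrier_eq by auto; pose proof (inv_succ_bounds y hy).
  unfold mcrit; rewrite <- rho_zero.
  replace (rho 0 ^ 2) with ((1 - 0) * rho 0 ^ 2) by ring; apply rho_weighted_anti; lra.
Qed.

(** State evolution with [c = 4 / delta] and [a] for |alpha|; psi_1 preserves the phase of alpha, so
    the modulus suffices. *)
Definition orbit (c w : R) (a s : nat -> R) : Prop :=
  (forall n, a (S n) = phi (s n / a n ^ 2)) /\
  (forall n, s (S n) = c * gap_fun (a n ^ 2) (s n) + 4 * w).

Lemma gap_fun_nonneg (A s : R) : 0 < A -> 0 <= s -> 0 <= gap_fun A s.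
Proof.
  intros hA hs; unfold gap_fun; pose proof (ratio_unit A s hA hs).
  assert (e : A + s = sqrt (A + s) ^ 2) by (rewrite pow2_sqrt; lra).
  rewrite e at 1; apply quadratic_gap_nonneg; [lra | apply sqrt_pos].
Qed.

(** [sqrt (A + s)] is at most sqrt 2, below 3/2, while [ell] is at least [PI / 2]. This controls the
    first step, where [a 0] is not yet a value of [phi]. *)
Lemma gap_fun_le_one (A s : R) : 0 < A -> 0 <= s -> A + s <= 2 -> gap_fun A s <= 1.
Proof.
  intros hA hs h; unfold gap_fun; pose proof (ratio_unit A s hA hs).
  assert (e : sqrt (A + s) ^ 2 = A + s) by (apply pow2_sqrt; lra).
  pose proof (sqrt_pos (A + s)) as h0; set (r := sqrt (A + s)) in *.
  pose proof (ell_ge_tangent_zero (A / (A + s)) ltac:(lra)); pose proof PI_lower.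
  assert (15 / 10 <= ell (A / (A + s))) by nra.
  assert (r <= 15 / 10) by nra; nra.
Qed.

(** * Descent of an orbit to a neighbourhood of [y = 0] *)

Section Orbit.

Variables (th w : R) (a s : nat -> R).
Let c := th ^ 2 * (mcrit / (1 - mcrit)).
Hypothesis hth : 0 < th < 1.
Hypothesis hw : 0 < w.
Hypothesis horb : orbit c w a s.
Hypothesis ha0 : 0 < a 0%nat <= 1.
Hypothesis hs0 : 0 <= s 0%nat < 1.

Let y n := s n / a n ^ 2.

Lemma orbit_c_pos : 0 < c.
Proof.
  pose proof mcrit_bounds; apply Rmult_lt_0_compat; [apply pow_lt | apply Rdiv_lt_0_compat]; lra.
Qed.

Lemma orbit_bounds (n : nat) : 0 < a n <= 1 /\ 0 <= s n.
Proof.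
  induction n as [ | n [h1 h2]]; [lra | ].
  destruct horb as [ea es]; rewrite ea, es.
  assert (0 < a n ^ 2) by (apply pow_lt; lra).
  split; [apply phi_bounds, Rdiv_le_0_compat; lra | ].
  pose proof (gap_fun_nonneg (a n ^ 2) (s n) ltac:(lra) h2); pose proof orbit_c_pos.
  assert (0 <= c * gap_fun (a n ^ 2) (s n)) by (apply Rmult_le_pos; lra); lra.
Qed.

Lemma orbit_y_nonneg (n : nat) : 0 <= y n.
Proof.
  pose proof (orbit_bounds n); apply Rdiv_le_0_compat; [lra | apply pow_lt; lra].
Qed.

Lemma orbit_s_lower (n : nat) : 4 * w <= s (S n).
Proof.
  destruct horb as [_ es]; rewrite es; pose proof (orbit_bounds n); pose proof orbit_c_pos.
  pose proof (gap_fun_nonneg (a n ^ 2) (s n) ltac:(apply pow_lt; lra) ltac:(lra)).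
  assert (0 <= c * gap_fun (a n ^ 2) (s n)) by (apply Rmult_le_pos; lra); lra.
Qed.

(** Half of the margin [1 - th] is given up to absorb the noise. *)
Let thp := (1 + th) / 2.

Hypothesis hwm : 4 * w <= (thp - th) * mcrit.

(** The indices start at [S n] because only [a (S n) = phi (y n)] gives [a ^ 2] the form
    [xi * rho xi ^ 2] that [gap_contraction] needs, with [xi = / (1 + y n)]. The bound on [s] is
    propagated along with the step that uses it. *)
Lemma orbit_step (n : nat) :
  s (S n) <= mcrit / (1 - mcrit) /\
  s (S (S n)) <= th * Rmax (s (S n)) (barrier (y n)) + 4 * w.
Proof.
  pose proof mcrit_bounds as hm; set (c0 := mcrit / (1 - mcrit)) in *.
  assert (hc0 : mcrit <= c0).
  { unfold c0; apply (Rle_div_r mcrit mcrit (1 - mcrit)); nra. }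
  assert (hw' : 4 * w <= (1 - th) * c0) 
    by (unfold thp in hwm; assert (0 <= (1 - th) * (c0 - mcrit)) by (apply Rmult_le_pos; lra); nra).
  assert (step : forall k, s (S k) <= c0 ->
    s (S (S k)) <= th * Rmax (s (S k)) (barrier (y k)) + 4 * w).
  { intros k hk; destruct horb as [ea es]; rewrite (es (S k)); apply Rplus_le_compat_r.
    pose proof (orbit_y_nonneg k) as hy; pose proof (inv_succ_bounds (y k) hy) as hx.
    rewrite barrier_eq by auto.
    assert (eA : a (S k) ^ 2 = / (1 + y k) * rho (/ (1 + y k)) ^ 2).
    { rewrite ea; apply phi_sqr, hy. }
    pose proof (orbit_bounds k) as [hb1 hb2]; assert (hA : 0 < a k ^ 2) by (apply pow_lt; lra).
    apply gap_contraction; auto; [split; [apply orbit_bounds | exact hk] | ].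
    rewrite (es k); pose proof (gap_lower (/ (1 + y k)) (a k ^ 2) (s k) hb2 hA) as hg.
    replace (a k ^ 2 / (a k ^ 2 + s k)) with (/ (1 + y k)) in hg
      by (unfold y; field; repeat split; nra).
    pose proof orbit_c_pos.
    change (c * (1 - ell (/ (1 + y k)) ^ 2 / 4) <= c * gap_fun (a k ^ 2) (s k) + 4 * w).
    assert (c * (1 - ell (/ (1 + y k)) ^ 2 / 4) <= c * gap_fun (a k ^ 2) (s k))
      by (apply Rmult_le_compat_l; lra); lra. }
  assert (bd : forall k, s (S k) <= c0).
  { induction k as [ | k IH].
    - destruct horb as [_ es]; rewrite es.
      assert (hA : 0 < a 0%nat ^ 2) by (apply pow_lt; lra).
      pose proof (gap_fun_le_one (a 0%nat ^ 2) (s 0%nat) hA ltac:(lra) ltac:(nra)).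
      assert (c * gap_fun (a 0%nat ^ 2) (s 0%nat) <= c * 1)
        by (apply Rmult_le_compat_l; [left; apply orbit_c_pos | auto]).
      assert (c <= th * c0) by (unfold c; fold c0; nra); lra.
    - eapply Rle_trans; [apply step, IH | ].
      pose proof (barrier_le (y k) (orbit_y_nonneg k)).
      assert (Rmax (s (S k)) (barrier (y k)) <= c0) by (apply Rmax_lub; lra).
      assert (th * Rmax (s (S k)) (barrier (y k)) <= th * c0) by (apply Rmult_le_compat_l; lra).
      lra. }
  split; auto.
Qed.

(** [barrier] only approaches [mcrit] as [y] grows, so [s] has to get strictly below [mcrit] before
    some finite [Y] has [s (S n) <= barrier Y]. *)
Lemma orbit_enter : exists n, s (S n) <= thp * mcrit.
Proof.
  pose proof mcrit_bounds as hm; set (c0 := mcrit / (1 - mcrit)).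
  assert (hc0 : 0 < c0) by (apply Rdiv_lt_0_compat; lra).
  assert (hthp : 0 < thp < 1) by (unfold thp; lra).
  assert (dec : forall k, s (S k) <= Rmax (thp ^ k * c0) (thp * mcrit)).
  { induction k as [ | k IH].
    - eapply Rle_trans; [apply orbit_step | ]; fold c0; rewrite pow_O, Rmult_1_l; apply Rmax_l.
    - destruct (orbit_step k) as [_ h]; pose proof (barrier_le (y k) (orbit_y_nonneg k)) as hb.
      set (M := Rmax (s (S k)) mcrit).
      assert (hM : Rmax (s (S k)) (barrier (y k)) <= M).
      { unfold M; apply Rmax_lub; [apply Rmax_l | eapply Rle_trans; [exact hb | apply Rmax_r]]. }
      assert (hMm : mcrit <= M) by apply Rmax_r.
      assert (s (S (S k)) <= thp * M) by (unfold thp in *; nra).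
      eapply Rle_trans; [exact H | ]; unfold M.
      destruct (Rle_dec (s (S k)) mcrit) as [hl | hl].
      + rewrite Rmax_right by auto; apply Rmax_r.
      + rewrite Rmax_left by lra; eapply Rle_trans; [ | apply Rmax_l].
        assert (hk : s (S k) <= thp ^ k * c0).
        { revert IH; unfold Rmax at 1; destruct (Rle_dec (thp ^ k * c0) (thp * mcrit)); intros; auto.
          exfalso; nra. }
        simpl; rewrite Rmult_assoc; apply Rmult_le_compat_l; lra. }
  destruct (pow_lt_1_zero thp ltac:(rewrite Rabs_pos_eq; lra) (thp * mcrit / c0)
    ltac:(apply Rdiv_lt_0_compat; nra)) as [N hN].
  exists N; eapply Rle_trans; [apply dec | apply Rmax_lub; [ | lra]].
  specialize (hN N (Nat.le_refl N)); rewrite Rabs_pos_eq in hN by (apply pow_le; lra).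
  apply Rlt_le in hN; apply (Rmult_le_compat_r c0) in hN; [ | lra].
  replace (thp * mcrit / c0 * c0) with (thp * mcrit) in hN by (field; lra); exact hN.
Qed.

(** Because [barrier] is increasing, this says that V is at most [barrier Y], in a form that bounds
    [y] itself. *)
Let inv (n : nat) (Y : R) : Prop := 0 < Y /\ y n <= Y /\ s (S n) <= barrier Y.

(** [y (S n)] is [s (S n) / phi (y n) ^ 2], and [phi (y n)] is at least [phi Y]. *)
Lemma orbit_y_next (n : nat) (Y v : R) : 0 < Y -> y n <= Y -> s (S n) <= v * barrier Y ->
  y (S n) <= v * Y.
Proof.
  intros hY hy hs; unfold y at 1; destruct horb as [ea _].
  rewrite ea; fold (y n); pose proof (phi_anti (y n) Y (conj (orbit_y_nonneg n) hy)) as hp.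
  pose proof (phi_bounds Y ltac:(lra)); pose proof (phi_bounds (y n) (orbit_y_nonneg n)).
  pose proof (orbit_bounds (S n)) as [_ hs'].
  assert (hpp : phi Y ^ 2 <= phi (y n) ^ 2) by (apply pow_incr; lra).
  assert (0 < phi Y ^ 2) by (apply pow_lt; lra).
  apply Rle_div_l; [lra | ]; unfold barrier in hs.
  assert (hv : 0 <= v).
  { apply Rmult_le_reg_r with (Y * phi Y ^ 2); [apply Rmult_lt_0_compat; lra | lra]. }
  assert (v * Y * phi Y ^ 2 <= v * Y * phi (y n) ^ 2)
    by (apply Rmult_le_compat_l; [apply Rmult_le_pos; lra | lra]).
  lra.
Qed.

Lemma orbit_inv_start : exists n Y, inv n Y.
Proof.
  pose proof mcrit_bounds as hm; assert (hthp : 0 < thp < 1) by (unfold thp; lra).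
  destruct orbit_enter as [n hn]; pose proof (orbit_y_nonneg n) as hy.
  (* Chosen so that [/ (1 + Y0) = 1 - thp], whence [barrier Y0] is [thp * rho (1 - thp) ^ 2], at
     least [thp * mcrit]. *)
  set (Y0 := / (1 - thp) - 1).
  assert (hY0 : 0 < Y0).
  { unfold Y0; assert (1 < / (1 - thp)) by (rewrite <- Rinv_1 at 1; apply Rinv_lt_contravar; lra); lra. }
  pose proof (Rmax_l (y n) Y0); pose proof (Rmax_r (y n) Y0).
  exists n, (Rmax (y n) Y0); split; [lra | split; [auto | ]].
  apply Rle_trans with (barrier Y0); [ | apply barrier_incr; lra].
  rewrite barrier_eq by lra.
  replace (/ (1 + Y0)) with (1 - thp) by (unfold Y0; field; lra).
  eapply Rle_trans; [exact hn | ]; replace (1 - (1 - thp)) with thp by ring.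
  apply Rmult_le_compat_l; [lra | unfold mcrit; apply pow_incr].
  pose proof (rho_bounds (1 - thp) ltac:(lra)); pose proof PI_RGT_0; lra.
Qed.

(** Two steps are needed: the first shrinks [s] while [y] merely stays below [Y], the second passes
    the gain on to [y]. The smaller [s] fits the new level since
    [thp * barrier Y <= barrier (thp * Y)], [phi] being decreasing. *)
Lemma orbit_inv_step (e : R) (n : nat) (Y : R) : 0 < e <= Y ->
  4 * w <= (thp - th) * barrier e -> inv n Y -> inv (S (S n)) (thp * Y).
Proof.
  intros he hwe [hY [hy hs]]; assert (hthp : 0 < thp < 1) by (unfold thp; lra).
  pose proof (barrier_incr e Y ltac:(lra)) as hbe.
  assert (hb0 : 0 < barrier e).
  { pose proof (phi_bounds e ltac:(lra)); apply Rmult_lt_0_compat; [lra | apply pow_lt; lra]. }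
  assert (shr : forall k, y k <= Y -> s (S k) <= barrier Y -> s (S (S k)) <= thp * barrier Y).
  { intros k h1 h2; destruct (orbit_step k) as [_ h].
    pose proof (barrier_incr (y k) Y (conj (orbit_y_nonneg k) h1)).
    assert (Rmax (s (S k)) (barrier (y k)) <= barrier Y) by (apply Rmax_lub; lra).
    assert (th * Rmax (s (S k)) (barrier (y k)) <= th * barrier Y) by (apply Rmult_le_compat_l; lra).
    assert ((thp - th) * barrier e <= (thp - th) * barrier Y)
      by (apply Rmult_le_compat_l; [unfold thp | ]; lra).
    lra. }
  pose proof (shr n hy hs) as h1.
  pose proof (orbit_y_next n Y 1 hY hy ltac:(lra)) as hy1; rewrite Rmult_1_l in hy1.
  assert (hs1 : s (S (S n)) <= barrier Y) by nra.
  pose proof (shr (S n) hy1 hs1) as h2.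
  pose proof (orbit_y_next (S n) Y thp hY hy1 h1) as hy2.
  repeat split; [nra | exact hy2 | ].
  eapply Rle_trans; [exact h2 | ]; unfold barrier.
  pose proof (phi_anti (thp * Y) Y ltac:(nra)); pose proof (phi_bounds Y ltac:(lra)).
  rewrite Rmult_assoc; apply Rmult_le_compat_l; [lra | ].
  apply Rmult_le_compat_l; [lra | apply pow_incr; lra].
Qed.

(** Two consecutive small values are the initial data of the second-order local recursion. *)
Lemma orbit_reaches (e : R) : 0 < e -> 4 * w <= (thp - th) * barrier e ->
  exists n, y n <= e /\ y (S n) <= e.
Proof.
  intros he hwe; assert (hthp : 0 < thp < 1) by (unfold thp; lra).
  destruct orbit_inv_start as [n [Y hi]].
  assert (fin : forall k Z, Z <= e -> inv k Z -> exists n, y n <= e /\ y (S n) <= e).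
  { intros k Z hZ [h0 [h1 h2]]; exists k.
    pose proof (orbit_y_next k Z 1 h0 h1 ltac:(lra)); lra. }
  assert (run : forall j, (exists n, y n <= e /\ y (S n) <= e) \/ inv (n + 2 * j) (thp ^ j * Y)).
  { induction j as [ | j [IH | IH]]; [right | left; exact IH | ].
    - rewrite Nat.mul_0_r, Nat.add_0_r, pow_O, Rmult_1_l; exact hi.
    - destruct (Rle_dec e (thp ^ j * Y)) as [h | h].
      + right; replace (n + 2 * S j)%nat with (S (S (n + 2 * j))) by lia.
        simpl pow; rewrite Rmult_assoc; apply orbit_inv_step with e; auto.
      + left; apply (fin (n + 2 * j)%nat (thp ^ j * Y)); [lra | exact IH]. }
  destruct hi as [hY _].
  destruct (pow_lt_1_zero thp ltac:(rewrite Rabs_pos_eq; lra) (e / Y)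
    ltac:(apply Rdiv_lt_0_compat; lra)) as [N hN].
  destruct (run N) as [h | h]; [exact h | ].
  apply (fin _ _) with (2 := h); specialize (hN N (Nat.le_refl N)).
  rewrite Rabs_pos_eq in hN by (apply pow_le; lra).
  apply Rlt_le in hN; apply (Rmult_le_compat_r Y) in hN; [ | lra].
  replace (e / Y * Y) with e in hN by (field; lra); exact hN.
Qed.

End Orbit.

(** * Behaviour near the fixed point *)

(** At a fixed ratio [y], [gap_fun] is a quadratic in [a] with linear coefficient [- gfun y]. *)
Definition gfun (y : R) : R := sqrt (1 + y) * ell (/ (1 + y)).

Lemma gap_fun_scaled (a s : R) : 0 < a -> 0 <= s ->
  gap_fun (a ^ 2) s = a ^ 2 * (1 + s / a ^ 2) + 1 - a * gfun (s / a ^ 2).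
Proof.
  intros ha hs; assert (ha2 : 0 < a ^ 2) by (apply pow_lt; lra).
  assert (hy : 0 <= s / a ^ 2) by (apply Rdiv_le_0_compat; lra).
  assert (e : a ^ 2 + s = a ^ 2 * (1 + s / a ^ 2)) by (field; lra).
  unfold gap_fun, gfun.
  replace (a ^ 2 / (a ^ 2 + s)) with (/ (1 + s / a ^ 2)) by (field; repeat split; nra).
  rewrite e, sqrt_mult, sqrt_pow2 by lra; ring.
Qed.

Lemma gfun_zero : gfun 0 = 2.
Proof. unfold gfun; rewrite Rplus_0_r, Rinv_1, sqrt_1, ell_one; ring. Qed.

Lemma inv_succ_gap (y : R) : 0 <= y -> 0 <= 1 - / (1 + y) <= y.
Proof.
  intros hy; pose proof (inv_succ_bounds y hy) as hx; split; [lra | ].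
  apply Rmult_le_reg_r with (1 + y); [lra | ]; rewrite Rmult_minus_distr_r, Rinv_l by lra; nra.
Qed.

Lemma rho_gap_inv_succ (y : R) : 0 < y <= 1 ->
  1 - rho (/ (1 + y)) <= 4 * (sqrt y * sqrt (sqrt y)).
Proof.
  intros hy; pose proof (inv_succ_gap y ltac:(lra)) as hg; pose proof (inv_succ_bounds y ltac:(lra)).
  assert (h1 : 1 / 2 <= / (1 + y)).
  { replace (1 / 2) with (/ 2) by lra; apply Rinv_le_contravar; lra. }
  assert (h2 : / (1 + y) < 1) by (rewrite <- Rinv_1; apply Rinv_lt_contravar; lra).
  eapply Rle_trans; [apply rho_gap; lra | ]; apply Rmult_le_compat_l; [lra | ].
  assert (sqrt (1 - / (1 + y)) <= sqrt y) by (apply sqrt_le_1_alt; lra).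
  apply Rmult_le_compat; auto using sqrt_pos; apply sqrt_le_1_alt; auto.
Qed.

(** From [rho_gap], [1 - phi y] is of order y^(3/4); its square is therefore negligible against
    [y]. *)
Lemma phi_gap (y : R) : 0 < y <= 1 -> (1 - phi y) ^ 2 <= 25 * (y * sqrt y).
Proof.
  intros hy; pose proof (rho_gap_inv_succ y hy) as hr; pose proof (inv_succ_gap y ltac:(lra)) as hg.
  pose proof (inv_succ_bounds y ltac:(lra)) as hx.
  set (z := sqrt y) in *; assert (hz : 0 < z) by (apply sqrt_lt_R0; lra).
  assert (hz2 : z ^ 2 = y) by (apply pow2_sqrt; lra).
  set (q := sqrt z) in *; assert (hq : 0 < q) by (apply sqrt_lt_R0; lra).
  assert (hq2 : q ^ 2 = z) by (apply pow2_sqrt; lra).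
  assert (z <= 1) by nra; assert (hq1 : q <= 1) by nra.
  pose proof (phi_bounds y ltac:(lra)) as hp.
  set (x := / (1 + y)) in *; set (w := sqrt x).
  assert (hw2 : w ^ 2 = x) by (apply pow2_sqrt; lra).
  assert (hw : 0 < w) by (apply sqrt_lt_R0; lra); assert (w <= 1) by nra.
  assert (1 - w <= y) by nra.
  assert (1 - phi y <= y + 4 * (z * q)).
  { unfold phi; fold x w; pose proof (rho_bounds x ltac:(lra)); pose proof PI_lower; nra. }
  assert (h5 : 1 - phi y <= 5 * (z * q)).
  { assert (y <= z * q); [ | lra]; rewrite <- hz2; nra. }
  apply Rle_trans with ((5 * (z * q)) ^ 2); [apply pow_incr; lra | ].
  rewrite <- hz2; right; replace ((5 * (z * q)) ^ 2) with (25 * z ^ 2 * q ^ 2) by ring.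
  rewrite hq2; ring.
Qed.

(** [rho] has unbounded slope at [x = 1], so the constant must degenerate as [m] tends to 0. It is
    used with [m = 4 * w]. *)
Lemma phi_lipschitz (m y y' : R) : 0 < m -> m <= y <= y' -> y' <= 1 ->
  Rabs (phi y' - phi y) <= 3 / sqrt m * Rabs (y' - y).
Proof.
  intros hm hy hy1; pose proof (phi_anti y y' ltac:(lra)) as hanti.
  rewrite Rabs_left1, Rabs_pos_eq by lra.
  pose proof (inv_succ_bounds y ltac:(lra)) as hx; pose proof (inv_succ_bounds y' ltac:(lra)) as hx'.
  assert (e : / (1 + y) - / (1 + y') = (y' - y) * (/ (1 + y) * / (1 + y'))) by (field; lra).
  assert (hyx : m / 2 <= 1 - / (1 + y)).
  { replace (1 - / (1 + y)) with (y / (1 + y)) by (field; lra); apply (Rle_div_r (m / 2) y (1 + y)); nra. }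
  set (x := / (1 + y)) in *; set (x' := / (1 + y')) in *.
  assert (hxx : 0 <= x - x' <= y' - y) by (rewrite e; split; [repeat apply Rmult_le_pos; lra | ];
    assert (x * x' <= 1) by nra; nra).
  set (r := sqrt m); assert (hr : 0 < r) by (apply sqrt_lt_R0; lra).
  assert (hr2 : r ^ 2 = m) by (apply pow2_sqrt; lra); assert (hr1 : r <= 1) by nra.
  pose proof (rho_lipschitz x' x ltac:(lra) ltac:(lra)) as hl.
  set (z := sqrt (1 - x)) in *; assert (hz : 0 < z) by (apply sqrt_lt_R0; lra).
  assert (hz2 : z ^ 2 = 1 - x) by (apply pow2_sqrt; lra).
  assert (hrz : r <= 3 / 2 * z) by (apply Rsqr_incr_0_var; unfold Rsqr; nra).
  assert (hiz : / z <= 3 / 2 * / r).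
  { replace (3 / 2 * / r) with (/ (2 / 3 * r)) by (field; lra); apply Rinv_le_contravar; lra. }
  assert (h1r : 1 <= / r) by (rewrite <- Rinv_1; apply Rinv_le_contravar; lra).
  set (v := sqrt x); set (v' := sqrt x').
  assert (hv : 0 < v <= 1).
  { split; [apply sqrt_lt_R0; lra | ]; rewrite <- sqrt_1; apply sqrt_le_1_alt; lra. }
  assert (hv' : 0 < v') by (apply sqrt_lt_R0; lra).
  assert (hv2 : v ^ 2 = x) by (apply pow2_sqrt; lra).
  assert (hv2' : v' ^ 2 = x') by (apply pow2_sqrt; lra).
  assert (hvv : v' <= v) by (apply sqrt_le_1_alt; lra).
  pose proof (rho_bounds x ltac:(lra)); pose proof (rho_bounds x' ltac:(lra)); pose proof PI_lower.
  assert (hk : (v - v') * rho x' <= x - x').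
  { replace (x - x') with ((v - v') * (v + v')) by (transitivity (v ^ 2 - v' ^ 2); [ring | lra]).
    apply Rmult_le_compat_l; [lra | ].
    apply Rle_trans with 1; [lra | ].
    assert (1 / 2 <= x').
    { unfold x'; replace (1 / 2) with (/ 2) by lra; apply Rinv_le_contravar; lra. }
    nra. }
  unfold phi; fold x x' v v'.
  replace (- (v' * rho x' - v * rho x)) with ((v - v') * rho x' + v * (rho x - rho x')) by ring.
  assert (v * (rho x - rho x') <= (x - x') / z).
  { pose proof (rho_incr x' x ltac:(lra) ltac:(lra)); nra. }
  assert ((x - x') / z <= (x - x') * (3 / 2 * / r)) by (apply Rmult_le_compat_l; lra).
  unfold Rdiv at 1; nra.
Qed.

(** Near 0 the factor [sqrt (1 + y)] contributes slope 1/2 times [ell 1 = 2], and [ell (/ (1 + y))]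
    contributes [- rho 1 / 2]: in total 1/2. *)
Lemma gfun_increment (h y y' : R) : 0 <= y <= y' -> y' <= h -> h <= 1 ->
  Rabs (gfun y' - gfun y - (y' - y) / 2) <= 10 * sqrt h * (y' - y).
Proof.
  intros hy hh h1; destruct (Req_dec y y') as [<- | hn].
  { rewrite !Rminus_diag; unfold Rdiv; rewrite Rmult_0_l, Rminus_0_r, Rabs_R0; lra. }
  set (z := sqrt h); assert (hz : 0 < z) by (apply sqrt_lt_R0; lra).
  assert (hz2 : z ^ 2 = h) by (apply pow2_sqrt; lra); assert (z <= 1) by nra.
  assert (hhz : h <= z) by nra.
  pose proof (rho_gap_inv_succ y' ltac:(lra)) as hr.
  pose proof (inv_succ_gap y ltac:(lra)) as hg; pose proof (inv_succ_gap y' ltac:(lra)) as hg'.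
  pose proof (inv_succ_bounds y ltac:(lra)) as hx; pose proof (inv_succ_bounds y' ltac:(lra)) as hx'.
  assert (hr' : 1 - rho (/ (1 + y')) <= 4 * z).
  { eapply Rle_trans; [exact hr | ].
    assert (h2 : sqrt y' <= z) by (apply sqrt_le_1_alt; lra); pose proof (sqrt_pos y').
    assert (h3 : sqrt (sqrt y') <= 1).
    { apply Rle_trans with (sqrt 1); [apply sqrt_le_1_alt; lra | rewrite sqrt_1; lra]. }
    pose proof (sqrt_pos (sqrt y')); nra. }
  set (t := sqrt (1 + y')); set (t' := sqrt (1 + y)).
  assert (ht2 : t ^ 2 = 1 + y') by (apply pow2_sqrt; lra).
  assert (ht2' : t' ^ 2 = 1 + y) by (apply pow2_sqrt; lra).
  assert (ht0 : 0 < t) by (apply sqrt_lt_R0; lra); assert (ht0' : 0 < t') by (apply sqrt_lt_R0; lra).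
  assert (ht1 : 1 <= t <= 1 + h / 2) by (split; nra).
  assert (ht1' : 1 <= t' <= 1 + h / 2) by (split; nra).
  assert (hxe : / (1 + y) * (1 + y) = 1) by (field; lra).
  assert (hxe' : / (1 + y') * (1 + y') = 1) by (field; lra).
  unfold gfun; fold t t'; set (x := / (1 + y')) in *; set (x' := / (1 + y)) in *.
  assert (hxx : x' - x = (y' - y) * x * x') by (unfold x, x'; field; lra).
  set (D := y' - y) in *; assert (hD : 0 < D) by (unfold D; lra).
  pose proof (rho_bounds x ltac:(lra)) as hrx; pose proof (rho_bounds x' ltac:(lra)) as hrx'.
  pose proof PI_lower.
  assert (hDx : 0 <= D * x * x') by (repeat apply Rmult_le_pos; lra).
  pose proof (ell_bounds x x' ltac:(lra) ltac:(lra)) as hl; rewrite hxx in hl.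
  assert (hl1 : ell x' - ell x <= D * x * x' / 2) by nra.
  set (Y := x * x').
  assert (hY : 1 - 2 * h <= Y <= 1) by (unfold Y; split; nra).
  assert (hl2 : D * (1 / 2 - 3 * z) <= ell x' - ell x).
  { assert (1 - 4 * z - 2 * h <= Y * rho x) by nra.
    assert (1 / 2 - 3 * z <= Y * rho x / 2) by nra.
    assert (D * (1 / 2 - 3 * z) <= D * (Y * rho x / 2)) by (apply Rmult_le_compat_l; lra).
    unfold Y in *; lra. }
  pose proof (ell_ge_near_one x ltac:(lra)) as hn1; pose proof (ell_le_two x ltac:(lra)) as hn2.
  assert (et : t - t' = D / (t + t')).
  { apply Rmult_eq_reg_r with (t + t'); [ | lra].
    transitivity (t ^ 2 - t' ^ 2); [ring | ]; rewrite ht2, ht2'; unfold D; field; lra. }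
  assert (et2 : t - t' <= D / 2).
  { rewrite et; apply Rmult_le_compat_l; [lra | apply Rinv_le_contravar; lra]. }
  assert (et3 : D * (1 - h) <= (t - t') * ell x).
  { assert (eD : D = (t - t') * (t + t')) by (rewrite et; field; lra).
    assert (htt : 0 <= t - t') by (rewrite et; apply Rdiv_le_0_compat; lra).
    assert ((t + t') * (1 - h) <= (2 + h) * (1 - h)) by (apply Rmult_le_compat_r; lra).
    pose proof (pow2_ge_0 h).
    rewrite eD, Rmult_assoc; apply Rmult_le_compat_l; lra. }
  assert (hl3 : t' * (ell x' - ell x) <= D / 2).
  { assert (htx0 : 0 < t' * x') by (apply Rmult_lt_0_compat; lra).
    assert (htx : t' * x' <= 1).
    { assert (et' : t' * x' * t' = 1) by (rewrite <- hxe, <- ht2'; ring).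
      apply Rle_trans with (t' * x' * t'); [ | lra].
      rewrite <- (Rmult_1_r (t' * x')) at 1; apply Rmult_le_compat_l; lra. }
    assert (D * x * (t' * x') <= D * 1 * 1).
    { apply Rmult_le_compat; [apply Rmult_le_pos; lra | lra | | lra].
      apply Rmult_le_compat_l; lra. }
    apply Rle_trans with (t' * (D * x * x' / 2)); [apply Rmult_le_compat_l; lra | lra]. }
  assert (hl4 : D * (1 / 2 - 3 * z) <= t' * (ell x' - ell x)).
  { assert (h0 : 0 <= D * x * x' * rho x) by (apply Rmult_le_pos; lra).
    assert (hE : 0 <= (t' - 1) * (ell x' - ell x)) by (apply Rmult_le_pos; lra); lra. }
  assert ((t - t') * ell x <= D).
  { assert (htt : 0 <= t - t') by (rewrite et; apply Rdiv_le_0_compat; lra).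
    apply Rle_trans with ((t - t') * 2); [apply Rmult_le_compat_l; lra | lra]. }
  replace (t * ell x - t' * ell x' - D / 2) with ((t - t') * ell x - t' * (ell x' - ell x) - D / 2)
    by ring.
  assert (D * h <= D * z) by (apply Rmult_le_compat_l; lra).
  assert (0 <= D * z) by (apply Rmult_le_pos; lra).
  apply Rabs_le; split; lra.
Qed.

Lemma gfun_increment_abs (h y y' : R) : 0 <= y <= h -> 0 <= y' <= h -> h <= 1 ->
  Rabs (gfun y' - gfun y - (y' - y) / 2) <= 10 * sqrt h * Rabs (y' - y).
Proof.
  intros hy hy' hh; destruct (Rle_dec y y').
  - rewrite (Rabs_pos_eq (y' - y)) by lra; apply gfun_increment; lra.
  - rewrite (Rabs_left (y' - y)) by lra.
    rewrite <- Rabs_Ropp; replace (- (gfun y' - gfun y - (y' - y) / 2)) with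
      (gfun y - gfun y' - (y - y') / 2) by lra.
    rewrite Ropp_minus_distr; apply gfun_increment; lra.
Qed.

Lemma phi_lipschitz_abs (m y y' : R) : 0 < m -> m <= y <= 1 -> m <= y' <= 1 ->
  Rabs (phi y' - phi y) <= 3 / sqrt m * Rabs (y' - y).
Proof.
  intros hm hy hy'; destruct (Rle_dec y y'); [apply phi_lipschitz; lra | ].
  rewrite (Rabs_minus_sym (phi y')), (Rabs_minus_sym y'); apply phi_lipschitz; lra.
Qed.

(** * Convergence criteria and the size of the neighbourhood *)

Lemma geometric_increments_cv (u : nat -> R) (C q : R) : 0 <= q < 1 ->
  (forall n, Rabs (u (S n) - u n) <= C * q ^ n) -> exists l, Un_cv u l.
Proof.
  intros hq hu.
  assert (hs : ex_series (fun n => u (S n) - u n)).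
  { apply (ex_series_le (K := R_AbsRing) (V := R_CompleteNormedModule) _ (fun n => C * q ^ n)).
    - exact hu.
    - apply (ex_series_scal_l (K := R_AbsRing) C (fun n => q ^ n)), ex_series_geom.
      rewrite Rabs_pos_eq; lra. }
  destruct hs as [l hl]; exists (l + u 0%nat); apply is_lim_seq_Reals.
  apply is_lim_seq_incr_1.
  apply is_lim_seq_ext with (fun n => sum_n (fun k => u (S k) - u k) n + u 0%nat).
  - intros n; induction n as [ | n IH]; [rewrite sum_O; ring | ].
    rewrite sum_Sn; unfold plus; simpl; lra.
  - apply is_lim_seq_plus'; [exact hl | apply is_lim_seq_const].
Qed.

(** The combination [u (S n) + 3 / 100 * u n - 10 * k] contracts by 0.88: 0.85 + 0.03 = 0.88, 0.02
    is at most 0.88 * 0.03, and 9 exceeds 8.8. *)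
Lemma two_term_decay (u : nat -> R) (k : R) :
  (forall n, 0 <= u n) -> 0 <= k ->
  (forall n, u (S (S n)) <= 85 / 100 * u (S n) + 2 / 100 * u n + k) ->
  forall n, u (S n) <= (u 0%nat + u 1%nat) * (88 / 100) ^ n + 10 * k.
Proof.
  intros hu hk hrec n.
  assert (h : u (S n) + 3 / 100 * u n - 10 * k <= (u 0%nat + u 1%nat) * (88 / 100) ^ n).
  { induction n as [ | n IH].
    - pose proof (hu 0%nat); simpl; lra.
    - pose proof (hrec n); pose proof (hu n); pose proof (hu (S n)); simpl; lra. }
  pose proof (hu n); lra.
Qed.

Lemma lipschitz_seq_cv (f : R -> R) (u : nat -> R) (l K : R) : 0 < K ->
  (forall n, Rabs (f (u n) - f l) <= K * Rabs (u n - l)) -> Un_cv u l ->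
  Un_cv (fun n => f (u n)) (f l).
Proof.
  intros hK hf hu e he; destruct (hu (e / K) ltac:(apply Rdiv_lt_0_compat; lra)) as [N hN].
  exists N; intros n hn; unfold Rdist in *; eapply Rle_lt_trans; [apply hf | ].
  specialize (hN n hn); apply Rlt_div_r in hN; lra.
Qed.

Lemma phi_zero : phi 0 = 1.
Proof. unfold phi; rewrite Rplus_0_r, Rinv_1, sqrt_1, rho_one; ring. Qed.

Lemma phi_gap_closed (y : R) : 0 <= y <= 1 -> (1 - phi y) ^ 2 <= 25 * (y * sqrt y).
Proof.
  intros hy; destruct (Req_dec y 0) as [-> | hn]; [rewrite phi_zero; lra | apply phi_gap; lra].
Qed.

(** Makes the factors [25 * sqrt y] of [phi_gap_closed] and [10 * sqrt h] of [gfun_increment_abs] at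
    most 1/400 and 1/1000. *)
Definition small_radius : R := (1 / 10000) ^ 2.

Lemma small_radius_facts (y : R) : 0 <= y <= small_radius ->
  (1 - phi y) ^ 2 <= y / 100 /\ 999 / 1000 <= phi y <= 1.
Proof.
  intros hy; unfold small_radius in hy.
  pose proof (phi_gap_closed y ltac:(lra)) as h; pose proof (phi_bounds y ltac:(lra)) as hp.
  assert (hs : sqrt y <= 1 / 10000).
  { apply Rle_trans with (sqrt ((1 / 10000) ^ 2)); [apply sqrt_le_1_alt; lra | ].
    right; apply sqrt_pow2; lra. }
  assert (y * sqrt y <= y * (1 / 10000)) by (apply Rmult_le_compat_l; lra).
  split; [lra | split; [ | lra]].
  assert ((1 - phi y) ^ 2 <= (1 / 1000) ^ 2) by lra.
  assert (1 - phi y <= 1 / 1000) by (apply Rsqr_incr_0_var; unfold Rsqr; lra); lra.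
Qed.

Lemma gfun_increment_small (y y' : R) : 0 <= y <= small_radius -> 0 <= y' <= small_radius ->
  Rabs (gfun y' - gfun y - (y' - y) / 2) <= 1 / 1000 * Rabs (y' - y).
Proof.
  intros hy hy'; pose proof (gfun_increment_abs small_radius y y' hy hy') as h.
  unfold small_radius in h at 2; rewrite sqrt_pow2 in h by lra.
  unfold small_radius in *; specialize (h ltac:(lra)); lra.
Qed.

(** * Contraction at the scale of the noise *)

Section Local.

Variables (c w : R) (a s : nat -> R).
Hypothesis hc : 0 < c <= 162 / 100.
Hypothesis hw : 0 < w <= (1 / 10 ^ 11) ^ 2.
Hypothesis horb : orbit c w a s.
Hypothesis hpos : forall n, 0 < a n <= 1 /\ 0 <= s n.
Hypothesis hlow : forall n, 4 * w <= s (S n).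

Let y n := s n / a n ^ 2.

Hypothesis hy0 : y 0%nat <= small_radius.
Hypothesis hy1 : y 1%nat <= small_radius.

Lemma local_y_nonneg (n : nat) : 0 <= y n.
Proof. pose proof (hpos n); apply Rdiv_le_0_compat; [lra | apply pow_lt; lra]. Qed.

Lemma local_s_eq (n : nat) : s n = y n * a n ^ 2.
Proof. pose proof (hpos n); unfold y; field; lra. Qed.

Lemma local_s_next (n : nat) :
  s (S n) = c * (a n ^ 2 * (1 + y n) + 1 - a n * gfun (y n)) + 4 * w.
Proof.
  destruct horb as [_ es]; rewrite es; pose proof (hpos n).
  rewrite gap_fun_scaled by lra; reflexivity.
Qed.

Lemma local_a_next (n : nat) : a (S n) = phi (y n).
Proof. destruct horb as [ea _]; apply ea. Qed.

Lemma local_y_lower (n : nat) : 4 * w <= y (S n).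
Proof.
  pose proof (hlow n) as h; rewrite local_s_eq in h; pose proof (hpos (S n)).
  pose proof (local_y_nonneg (S n)); assert (a (S n) ^ 2 <= 1) by nra; nra.
Qed.

(** The main rate is [c / 2], at most 0.81. The term in [y n] comes from [(1 - a (S n)) ^ 2], as
    [a (S n) = phi (y n)]. *)
Lemma local_recursion (n : nat) : y n <= small_radius -> y (S n) <= small_radius ->
  y (S (S n)) <= 85 / 100 * y (S n) + 2 / 100 * y n + 5 * w.
Proof.
  intros h1 h2; pose proof (local_y_nonneg n) as p1; pose proof (local_y_nonneg (S n)) as p2.
  destruct (small_radius_facts (y n) ltac:(lra)) as [f1 f2]; rewrite <- local_a_next in f1, f2.
  destruct (small_radius_facts (y (S n)) ltac:(lra)) as [_ f3]; rewrite <- local_a_next in f3.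
  assert (hr : 0 <= small_radius) by (unfold small_radius; lra).
  pose proof (gfun_increment_small 0 (y (S n)) ltac:(lra) ltac:(lra)) as hg.
  rewrite gfun_zero, Rminus_0_r, (Rabs_pos_eq (y (S n))) in hg by lra.
  apply Rabs_le_between in hg.
  pose proof (local_s_next (S n)) as hs; rewrite local_s_eq in hs.
  set (Y := y (S n)) in *; set (A := a (S n)) in *; set (G := gfun Y) in *.
  assert (hb : A ^ 2 * (1 + Y) + 1 - A * G <= y n / 100 + 501 / 1000 * Y).
  { replace (A ^ 2 * (1 + Y) + 1 - A * G) with ((1 - A) ^ 2 + (A ^ 2 - A / 2) * Y - A * (G - 2 - Y / 2))
      by field.
    assert ((A ^ 2 - A / 2) * Y <= 1 / 2 * Y) by (apply Rmult_le_compat_r; nra).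
    assert (A * (- (1 / 1000 * Y)) <= A * (G - 2 - Y / 2)) by (apply Rmult_le_compat_l; lra).
    nra. }
  assert (hcb : c * (A ^ 2 * (1 + Y) + 1 - A * G) <= 162 / 100 * (y n / 100 + 501 / 1000 * Y)).
  { apply Rle_trans with (c * (y n / 100 + 501 / 1000 * Y)); [apply Rmult_le_compat_l; lra | ].
    apply Rmult_le_compat_r; lra. }
  assert (ha2 : 998 / 1000 <= a (S (S n)) ^ 2) by nra.
  pose proof (local_y_nonneg (S (S n))).
  assert (y (S (S n)) * (998 / 1000) <= y (S (S n)) * a (S (S n)) ^ 2)
    by (apply Rmult_le_compat_l; lra).
  lra.
Qed.

Lemma local_trapped (n : nat) : y n <= small_radius.
Proof.
  cut (y n <= small_radius /\ y (S n) <= small_radius); [tauto | ].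
  induction n as [ | n [h1 h2]]; [split; auto | split; [exact h2 | ]].
  pose proof (local_recursion n h1 h2); unfold small_radius in *; lra.
Qed.

Lemma local_y_small : exists N, forall n, y (n + N)%nat <= 60 * w.
Proof.
  pose proof (two_term_decay y (5 * w) local_y_nonneg ltac:(lra)
    (fun n => local_recursion n (local_trapped n) (local_trapped (S n)))) as hd.
  set (K := y 0%nat + y 1%nat) in *.
  assert (hK : 0 <= K) by (pose proof (local_y_nonneg 0); pose proof (local_y_nonneg 1); unfold K; lra).
  (* Once the geometric part is below [10 * w], the residual [10 * (5 * w)] brings the total to
     [60 * w]. *)
  destruct (pow_lt_1_zero (88 / 100) ltac:(rewrite Rabs_pos_eq; lra) (10 * w / (K + 1))
    ltac:(apply Rdiv_lt_0_compat; lra)) as [N hN].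
  exists (S N); intros n; rewrite <- plus_n_Sm; eapply Rle_trans; [apply hd | ].
  specialize (hN (n + N)%nat ltac:(lia)); rewrite Rabs_pos_eq in hN by (apply pow_le; lra).
  apply Rlt_div_r in hN; [ | lra]; pose proof (pow_le (88 / 100) (n + N) ltac:(lra)); nra.
Qed.

(** With [v = sqrt w], increments of [a] cost a factor of order [1 / v] over those of [y]. They
    occur only multiplied by [E], of order [v], or by [y], of order [v ^ 2], so the rate stays close
    to [c / 2]. *)
Lemma local_increments (n : nat) :
  (forall k, y (k + n)%nat <= 60 * w) -> (forall k, 4 * w <= y (k + n)%nat) ->
  Rabs (y (S (S (S n))) - y (S (S n))) <=
  85 / 100 * Rabs (y (S (S n)) - y (S n)) + 2 / 100 * Rabs (y (S n) - y n).
Proof.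
  intros hup hlo.
  set (v := sqrt w); assert (hv : 0 < v) by (apply sqrt_lt_R0; lra).
  assert (hv2 : v ^ 2 = w) by (apply pow2_sqrt; lra).
  assert (hv1 : v <= 1 / 10 ^ 11) by (apply Rsqr_incr_0_var; unfold Rsqr; lra).
  assert (h1v : 60 * w <= 1) by lra.
  assert (lip : forall x x', 4 * w <= x <= 60 * w -> 4 * w <= x' <= 60 * w ->
    Rabs (phi x' - phi x) <= 3 / 2 / v * Rabs (x' - x)).
  { intros x x' h h'; pose proof (phi_lipschitz_abs (4 * w) x x' ltac:(lra) ltac:(lra) ltac:(lra)) as hl.
    replace (sqrt (4 * w)) with (2 * v) in hl.
    - replace (3 / 2 / v) with (3 / (2 * v)) by (field; lra); exact hl.
    - rewrite <- hv2; replace (4 * v ^ 2) with ((2 * v) ^ 2) by ring; rewrite sqrt_pow2; lra. }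
  assert (gap : forall x, 4 * w <= x <= 60 * w -> 0 <= 1 - phi x <= v / 1000).
  { intros x h; pose proof (phi_bounds x ltac:(lra)); split; [lra | ].
    pose proof (phi_gap_closed x ltac:(lra)) as hg.
    assert (sqrt x <= 8 * v).
    { apply Rle_trans with (sqrt ((8 * v) ^ 2)); [apply sqrt_le_1_alt; nra | ].
      right; apply sqrt_pow2; lra. }
    pose proof (sqrt_pos x).
    assert (x * sqrt x <= 60 * w * (8 * v)) by (apply Rmult_le_compat; lra).
    apply Rsqr_incr_0_var; [unfold Rsqr | lra].
    assert (w * v <= w * (1 / 10 ^ 11)) by (apply Rmult_le_compat_l; lra).
    apply Rle_trans with (w / 1000000); [lra | rewrite <- hv2; lra]. }
  pose proof (conj (hlo 0%nat) (hup 0%nat)) as b0; pose proof (conj (hlo 1%nat) (hup 1%nat)) as b1;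
  pose proof (conj (hlo 2%nat) (hup 2%nat)) as b2; cbn [Nat.add] in b0, b1, b2.
  pose proof (local_trapped (S n)) as t1; pose proof (local_trapped (S (S n))) as t2.
  pose proof (lip _ _ b0 b1) as l0; pose proof (lip _ _ b1 b2) as l1.
  pose proof (gap _ b0) as g0; pose proof (gap _ b1) as g1; pose proof (gap _ b2) as g2.
  rewrite <- !local_a_next in l0, l1; rewrite <- local_a_next in g0, g1, g2.
  pose proof (gfun_increment_small (y (S n)) (y (S (S n))) ltac:(lra) ltac:(lra)) as hg.
  assert (hr : 0 <= small_radius) by (unfold small_radius; lra).
  pose proof (gfun_increment_small 0 (y (S n)) ltac:(lra) ltac:(lra)) as hg0.
  rewrite gfun_zero, Rminus_0_r, (Rabs_pos_eq (y (S n))) in hg0 by lra.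
  apply Rabs_le_between in hg0.
  pose proof (local_s_next (S n)) as s1; pose proof (local_s_next (S (S n))) as s2.
  rewrite local_s_eq in s1, s2.
  set (y0 := y n) in *; set (y1' := y (S n)) in *; set (y2 := y (S (S n))) in *.
  set (y3 := y (S (S (S n)))) in *.
  set (a1 := a (S n)) in *; set (a2 := a (S (S n))) in *; set (a3 := a (S (S (S n)))) in *.
  set (G1 := gfun y1') in *; set (G2 := gfun y2) in *.
  set (Dp := Rabs (y1' - y0)) in *; set (Dy := Rabs (y2 - y1')) in *.
  assert (hDp : 0 <= Dp) by apply Rabs_pos; assert (hDy : 0 <= Dy) by apply Rabs_pos.
  (* The divided difference in [a] of the gap at fixed [y]; at [a = 1], [y = 0] it is 2 - 2 = 0,
     hence small here. *)
  set (E := (a2 + a1) * (1 + y1') - G1).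
  assert (hE : Rabs E <= 3 / 1000 * v).
  { assert (w <= v * (1 / 10 ^ 11)) by nra.
    assert (0 <= y1' * (a2 + a1) <= y1' * 2) by (split; [apply Rmult_le_pos | apply Rmult_le_compat_l]; lra).
    unfold E; apply Rabs_le; split; lra. }
  assert (id : (y3 - y2) * a3 ^ 2 = c * ((a2 - a1) * E + (a2 ^ 2 - a2 / 2) * (y2 - y1')
     - a2 * (G2 - G1 - (y2 - y1') / 2)) - y2 * ((a3 - a2) * (a3 + a2))).
  { unfold E; lra. }
  assert (b1' : Rabs ((a2 - a1) * E) <= 45 / 10000 * Dp).
  { rewrite Rabs_mult; apply Rle_trans with (3 / 2 / v * Dp * (3 / 1000 * v)).
    - apply Rmult_le_compat; auto using Rabs_pos.
    - right; field; lra. }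
  assert (b2' : Rabs ((a2 ^ 2 - a2 / 2) * (y2 - y1')) <= 1 / 2 * Dy).
  { rewrite Rabs_mult; fold Dy; apply Rmult_le_compat_r; [auto | ].
    apply Rabs_le; assert (9 / 10 <= a2 <= 1) by lra; nra. }
  assert (b3 : Rabs (a2 * (G2 - G1 - (y2 - y1') / 2)) <= 1 / 1000 * Dy).
  { rewrite Rabs_mult, (Rabs_pos_eq a2) by lra.
    rewrite <- (Rmult_1_l (1 / 1000 * Dy)); apply Rmult_le_compat; auto using Rabs_pos; lra. }
  assert (b4 : Rabs (y2 * ((a3 - a2) * (a3 + a2))) <= 1 / 1000 * Dy).
  { rewrite !Rabs_mult, (Rabs_pos_eq y2), (Rabs_pos_eq (a3 + a2)) by lra.
    apply Rle_trans with (60 * w * (3 / 2 / v * Dy * 2)).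
    - apply Rmult_le_compat; [lra | apply Rmult_le_pos; [apply Rabs_pos | lra] | lra | ].
      apply Rmult_le_compat; auto using Rabs_pos; lra.
    - rewrite <- hv2; replace (60 * v ^ 2 * (3 / 2 / v * Dy * 2)) with (180 * v * Dy) by (field; lra).
      apply Rmult_le_compat_r; lra. }
  assert (ha3 : 99 / 100 <= a3 ^ 2) by (assert (999 / 1000 <= a3 <= 1) by lra; nra).
  assert (fin : Rabs ((y3 - y2) * a3 ^ 2) <= 162 / 100 * (45 / 10000 * Dp + 501 / 1000 * Dy) + 1 / 1000 * Dy).
  { rewrite id; eapply Rle_trans; [apply Rabs_triang | rewrite Rabs_Ropp].
    apply Rplus_le_compat; [ | exact b4].
    rewrite Rabs_mult, (Rabs_pos_eq c) by lra.
    apply Rmult_le_compat; [lra | apply Rabs_pos | lra | ].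
    eapply Rle_trans; [apply Rabs_triang | rewrite Rabs_Ropp].
    eapply Rle_trans; [apply Rplus_le_compat_r, Rabs_triang | lra]. }
  rewrite Rabs_mult, (Rabs_pos_eq (a3 ^ 2)) in fin by (apply pow2_ge_0).
  assert (Rabs (y3 - y2) * (99 / 100) <= Rabs (y3 - y2) * a3 ^ 2)
    by (apply Rmult_le_compat_l; [apply Rabs_pos | lra]).
  lra.
Qed.

Lemma local_y_cv : exists l, Un_cv y l /\ 4 * w <= l <= 60 * w.
Proof.
  destruct local_y_small as [N hN].
  (* The shift is [S N] because the lower bound [4 * w] holds from index 1 on only. *)
  set (u := fun k => y (k + S N)%nat).
  assert (hub : forall k, 4 * w <= u k <= 60 * w).
  { intros k; unfold u; split; [rewrite <- plus_n_Sm; apply local_y_lower | ].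
    rewrite <- plus_n_Sm, <- plus_Sn_m; apply hN. }
  destruct (geometric_increments_cv (fun n => u (S n))
    (Rabs (u 1%nat - u 0%nat) + Rabs (u 2%nat - u 1%nat)) (88 / 100) ltac:(lra)) as [l hl].
  { intros n; pose proof (two_term_decay (fun k => Rabs (u (S k) - u k)) 0) as hd; cbv beta in hd.
    specialize (hd (fun k => Rabs_pos _) ltac:(lra)).
    replace (10 * 0) with 0 in hd by ring.
    eapply Rle_trans; [apply hd | right; ring].
    intros k; rewrite Rplus_0_r.
    apply (local_increments (k + S N)).
    - intros j; rewrite Nat.add_assoc; apply hub.
    - intros j; rewrite Nat.add_assoc; apply hub. }
  exists l; apply is_lim_seq_Reals in hl.
  split.
  - apply is_lim_seq_Reals, (is_lim_seq_incr_n y (S (S N))).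
    apply is_lim_seq_ext with (2 := hl); intros n; unfold u; f_equal; lia.
  - split; [apply (is_lim_seq_le (fun _ => 4 * w) (fun n => u (S n)) (4 * w) l) |
            apply (is_lim_seq_le (fun n => u (S n)) (fun _ => 60 * w) l (60 * w))];
      auto using is_lim_seq_const; intros n; apply hub.
Qed.

(** The limit [l] of [y] solves the fixed-point equation, which reads [l * (1 - c / 2) = 4 * w] up
    to terms of order l^(3/2); the error in [a] enters [L] at that order too. *)
Lemma local_mse : exists L, Un_cv (fun n => (1 - a n) ^ 2 + s n) L /\
  Rabs (L / w - 4 / (1 - c / 2)) <= 10 ^ 6 * sqrt w.
Proof.
  destruct local_y_cv as [l [hl hlb]].
  set (v := sqrt w); assert (hv : 0 < v) by (apply sqrt_lt_R0; lra).
  assert (hv2 : v ^ 2 = w) by (apply pow2_sqrt; lra).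
  assert (hsr : 60 * w <= small_radius) by (unfold small_radius; lra).
  assert (hS : Un_cv (fun n => y (S n)) l).
  { apply is_lim_seq_Reals; apply -> is_lim_seq_incr_1; apply is_lim_seq_Reals, hl. }
  assert (hA : is_lim_seq (fun n => a (S (S n))) (phi l)).
  { apply is_lim_seq_ext with (fun n => phi (y (S n))); [intros n; symmetry; apply local_a_next | ].
    apply is_lim_seq_Reals.
    apply (lipschitz_seq_cv phi (fun n => y (S n)) l (3 / sqrt (4 * w))); auto.
    - apply Rdiv_lt_0_compat; [lra | apply sqrt_lt_R0; lra].
    - intros n; pose proof (local_y_lower n); pose proof (local_trapped (S n)).
      apply phi_lipschitz_abs; unfold small_radius in *; lra. }
  assert (hY : is_lim_seq (fun n => y (S (S n))) l).
  { apply -> (is_lim_seq_incr_1 (fun n => y (S n))); apply is_lim_seq_Reals, hS. }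
  assert (hG : is_lim_seq (fun n => gfun (y (S (S n)))) (gfun l)).
  { apply is_lim_seq_Reals, (lipschitz_seq_cv gfun (fun n => y (S (S n))) l 1); [lra | | ].
    - intros n; pose proof (local_y_nonneg (S (S n))); pose proof (local_trapped (S (S n))).
      pose proof (gfun_increment_small l (y (S (S n))) ltac:(lra) ltac:(lra)) as h.
      set (D := y (S (S n)) - l) in *.
      replace (gfun (y (S (S n))) - gfun l) with
        ((gfun (y (S (S n))) - gfun l - D / 2) + D / 2) by ring.
      eapply Rle_trans; [apply Rabs_triang | ].
      unfold Rdiv at 2; rewrite Rabs_mult, (Rabs_pos_eq (/ 2)) by lra.
      pose proof (Rabs_pos D); lra.
    - apply is_lim_seq_Reals, hY. }
  set (p := phi l) in *; set (g := gfun l) in *.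
  assert (hA2 : is_lim_seq (fun n => a (S (S n)) ^ 2) (p ^ 2)).
  { simpl; apply is_lim_seq_mult'; [exact hA | apply is_lim_seq_mult'; [exact hA | apply is_lim_seq_const]]. }
  assert (hs : is_lim_seq (fun n => s (S (S n))) (l * p ^ 2)).
  { apply is_lim_seq_ext with (fun n => y (S (S n)) * a (S (S n)) ^ 2);
      [intros n; symmetry; apply local_s_eq | apply is_lim_seq_mult'; auto]. }
  assert (hfix : l * p ^ 2 = c * (p ^ 2 * (1 + l) + 1 - p * g) + 4 * w).
  { assert (h1 : is_lim_seq (fun n => s (S (S (S n)))) (l * p ^ 2))
      by (apply -> (is_lim_seq_incr_1 (fun n => s (S (S n)))); exact hs).
    assert (h2 : is_lim_seq (fun n => s (S (S (S n)))) (c * (p ^ 2 * (1 + l) + 1 - p * g) + 4 * w)).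
    { apply is_lim_seq_ext with (fun n => c * (a (S (S n)) ^ 2 * (1 + y (S (S n))) + 1
        - a (S (S n)) * gfun (y (S (S n)))) + 4 * w); [intros n; symmetry; apply local_s_next | ].
      apply is_lim_seq_plus'; [ | apply is_lim_seq_const].
      apply is_lim_seq_mult'; [apply is_lim_seq_const | ].
      apply is_lim_seq_minus'; [ | apply is_lim_seq_mult'; auto].
      apply is_lim_seq_plus'; [ | apply is_lim_seq_const].
      apply is_lim_seq_mult'; [auto | ].
      apply is_lim_seq_plus'; [apply is_lim_seq_const | auto]. }
    pose proof (is_lim_seq_unique _ _ h1) as e1; rewrite (is_lim_seq_unique _ _ h2) in e1.
    injection e1; auto. }
  exists ((1 - p) ^ 2 + l * p ^ 2); split.
  - apply is_lim_seq_Reals, (is_lim_seq_incr_n _ 2).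
    apply is_lim_seq_ext with (fun n => (1 - a (S (S n))) ^ 2 + s (S (S n))).
    { intros n; replace (n + 2)%nat with (S (S n)) by lia; reflexivity. }
    apply is_lim_seq_plus'; [ | exact hs].
    assert (hm : is_lim_seq (fun n => 1 - a (S (S n))) (1 - p))
      by (apply is_lim_seq_minus'; [apply is_lim_seq_const | exact hA]).
    simpl; apply is_lim_seq_mult'; [exact hm | apply is_lim_seq_mult'; [exact hm | apply is_lim_seq_const]].
  - assert (hl1 : l <= 1) by (unfold small_radius in hsr; lra).
    pose proof (phi_gap_closed l ltac:(lra)) as hd; fold p in hd.
    pose proof (phi_bounds l ltac:(lra)) as hp; fold p in hp.
    pose proof (gfun_increment_abs l 0 l ltac:(lra) ltac:(lra) hl1) as hg.
    rewrite gfun_zero, Rminus_0_r, (Rabs_pos_eq l) in hg by lra; fold g in hg.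
    set (q := sqrt l) in *; assert (hq : 0 < q) by (apply sqrt_lt_R0; lra).
    assert (hq2 : q ^ 2 = l) by (apply pow2_sqrt; lra); assert (hq1 : q <= 1) by nra.
    set (d := 1 - p) in *; assert (hd0 : 0 <= d <= 1) by (unfold d; lra).
    assert (hd5 : d <= 5 * q).
    { apply Rsqr_incr_0_var; [unfold Rsqr | lra].
      apply Rle_trans with (25 * (l * q)); [lra | ].
      replace (5 * q * (5 * q)) with (25 * q ^ 2) by ring; rewrite hq2; nra. }
    (* [T] is l^(3/2), the common size of all error terms. *)
    set (T := l * q); assert (hT : 0 < T) by (apply Rmult_lt_0_compat; lra).
    assert (hdl : 0 <= l * d <= 5 * T).
    { split; [apply Rmult_le_pos; lra | unfold T].
      replace (5 * (l * q)) with (l * (5 * q)) by ring; apply Rmult_le_compat_l; lra. }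
    assert (hdd : 0 <= l * d ^ 2 <= l * d).
    { split; [apply Rmult_le_pos; [lra | apply pow2_ge_0] | apply Rmult_le_compat_l; [lra | nra]]. }
    fold T in hd; apply Rabs_le_between in hg.
    set (e := g - 2 - l / 2) in *.
    assert (he : - (10 * T) <= p * e <= 10 * T).
    { assert (hgT : 10 * q * l = 10 * T) by (unfold T; ring); rewrite hgT in hg.
      split; [apply Rle_trans with (p * - (10 * T)) | apply Rle_trans with (p * (10 * T))];
        try (apply Rmult_le_compat_l; lra); nra. }
    assert (hep : p = 1 - d) by (unfold d; ring).
    assert (heq : l * (1 - c / 2) - 4 * w =
      2 * (l * d) - l * d ^ 2 + c * (d ^ 2 - 3 / 2 * (l * d) + l * d ^ 2 - p * e)).
    { assert (hge : g = e + 2 + l / 2) by (unfold e; ring); rewrite hge in hfix.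
      assert (hpe : p * (e + 2 + l / 2) = p * e + 2 * p + p * l / 2) by field.
      rewrite hpe in hfix; set (pe := p * e) in *; clearbody pe; rewrite hep in hfix; lra. }
    pose proof (pow2_ge_0 d).
    assert (hX : - (60 * T) <= d ^ 2 - 3 / 2 * (l * d) + l * d ^ 2 - p * e <= 60 * T) by lra.
    assert (hcX : - (100 * T) <= c * (d ^ 2 - 3 / 2 * (l * d) + l * d ^ 2 - p * e) <= 100 * T).
    { split; nra. }
    assert (hlw : Rabs (l * (1 - c / 2) - 4 * w) <= 110 * T) by (rewrite heq; apply Rabs_le; lra).
    assert (hL : Rabs (d ^ 2 + l * p ^ 2 - l) <= 35 * T).
    { replace (d ^ 2 + l * p ^ 2 - l) with (d ^ 2 - 2 * (l * d) + l * d ^ 2) by (rewrite hep; ring).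
      apply Rabs_le; lra. }
    set (k := 1 - c / 2) in *; assert (hk : 19 / 100 <= k) by (unfold k; lra).
    (* From [l <= 60 * w] and [q <= 8 * v]. The final error is then at most (35 + 110 * 6) * 480
       times [w * v], which is below [10 ^ 6 * (w * v)]. *)
    assert (hTw : T <= 480 * (w * v)).
    { assert (q <= 8 * v).
      { apply Rle_trans with (sqrt ((8 * v) ^ 2)); [apply sqrt_le_1_alt; nra | ].
        right; apply sqrt_pow2; lra. }
      unfold T; apply Rle_trans with (60 * w * (8 * v)); [apply Rmult_le_compat; lra | lra]. }
    replace ((d ^ 2 + l * p ^ 2) / w - 4 / k) with
      ((d ^ 2 + l * p ^ 2 - l) / w + (l * k - 4 * w) / k / w) by (field; lra).
    eapply Rle_trans; [apply Rabs_triang | ].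
    unfold Rdiv; rewrite !Rabs_mult, (Rabs_pos_eq (/ w)), (Rabs_pos_eq (/ k))
      by (left; apply Rinv_0_lt_compat; lra).
    assert (hik : / k <= 6).
    { replace 6 with (/ / 6) by field; apply Rinv_le_contravar; lra. }
    assert (hik0 : 0 < / k) by (apply Rinv_0_lt_compat; lra).
    rewrite <- Rmult_plus_distr_r; apply Rle_div_l; [lra | ].
    assert (Rabs (l * k - 4 * w) * / k <= 110 * T * 6)
      by (apply Rmult_le_compat; [apply Rabs_pos | lra.. ]).
    assert (0 < w * v) by (apply Rmult_lt_0_compat; lra).
    lra.
Qed.

End Local.

(** * State evolution *)

(** Whichever value [epsilon] selects is some [RiemannInt], and all of these agree with the
    Coquelicot integral. *)
Lemma RInt_integ (f : R -> R) : integrable f -> Defs.RInt f 0 (PI / 2) = integ f.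
Proof.
  intros hf; unfold Defs.RInt.
  match goal with |- ClassicalEpsilon.epsilon ?i ?P = _ =>
    destruct (ClassicalEpsilon.epsilon_spec i P) as [pr <-] end.
  - exists (RiemannInt (ex_RInt_Reals_0 _ _ _ hf)); eexists; reflexivity.
  - symmetry; apply RInt_Reals.
Qed.

Lemma sqrt_scaled_Rad (a s t : R) : 0 < a -> 0 <= s ->
  sqrt (a ^ 2 * sin t ^ 2 + s) = a * sqrt (1 + s / a ^ 2) * Rad (/ (1 + s / a ^ 2)) t.
Proof.
  intros ha hs; assert (hy : 0 <= s / a ^ 2) by (apply Rdiv_le_0_compat; [lra | apply pow_lt; lra]).
  pose proof (inv_succ_bounds _ hy) as hx; pose proof (cos_sqr_bound t).
  assert (es : s = a ^ 2 * (s / a ^ 2)) by (field; lra).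
  set (y := s / a ^ 2) in *; set (x := / (1 + y)) in *.
  assert (hr : 0 <= 1 - x * cos t ^ 2) by nra.
  unfold Rad; rewrite Rmult_assoc, <- sqrt_mult by lra.
  transitivity (sqrt (a ^ 2) * sqrt ((1 + y) * (1 - x * cos t ^ 2))).
  - rewrite <- sqrt_mult by (try apply Rmult_le_pos; nra).
    f_equal; rewrite sin_cos_sqr, es; unfold x; field; lra.
  - rewrite sqrt_pow2 by lra; reflexivity.
Qed.

Lemma I1_phi (a s : R) : 0 < a -> 0 <= s -> I1 a s = phi (s / a ^ 2).
Proof.
  intros ha hs; assert (hy : 0 <= s / a ^ 2) by (apply Rdiv_le_0_compat; [lra | apply pow_lt; lra]).
  pose proof (inv_succ_bounds _ hy) as hx.
  assert (e : forall t, 0 < t < PI / 2 ->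
    sqrt (/ (1 + s / a ^ 2)) * (sin t ^ 2 / Rad (/ (1 + s / a ^ 2)) t) =
    a * sin t ^ 2 / sqrt (a ^ 2 * sin t ^ 2 + s)).
  { intros t ht; rewrite sqrt_scaled_Rad, sqrt_inv by lra.
    pose proof (Rad_pos_inner (/ (1 + s / a ^ 2)) t ltac:(lra) ht).
    assert (0 < sqrt (1 + s / a ^ 2)) by (apply sqrt_lt_R0; lra).
    field; repeat split; lra. }
  assert (hi := integrable_scal _ (sqrt (/ (1 + s / a ^ 2))) (rho_integrable (/ (1 + s / a ^ 2)) ltac:(lra))).
  unfold I1; rewrite RInt_integ by (apply (integrable_ext _ _ e hi)).
  rewrite <- (integ_ext _ _ e), integ_scal by (apply rho_integrable; lra); reflexivity.
Qed.

(** The numerator is twice the radicand minus [s]; with the radicand equal to [r ^ 2 * Rad x t ^ 2]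
    and [s = r ^ 2 * (1 - x)] this is [r] times the integrand of [ell]. *)
Lemma psi2_gap (al : Cpx) (s d w : R) : 0 < Cmod al -> 0 <= s ->
  psi2 al s d w = 4 / d * gap_fun (Cmod al ^ 2) s + 4 * w.
Proof.
  intros ha hs; set (a := Cmod al) in *.
  assert (ha2 : 0 < a ^ 2) by (apply pow_lt; lra).
  assert (hy : 0 <= s / a ^ 2) by (apply Rdiv_le_0_compat; lra).
  pose proof (inv_succ_bounds _ hy) as hx; set (x := / (1 + s / a ^ 2)) in *.
  set (r := a * sqrt (1 + s / a ^ 2)).
  assert (hsq : 0 < sqrt (1 + s / a ^ 2)) by (apply sqrt_lt_R0; lra).
  assert (hr : 0 < r) by (apply Rmult_lt_0_compat; lra).
  assert (hr2 : r ^ 2 = a ^ 2 + s).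
  { unfold r; rewrite Rpow_mult_distr, pow2_sqrt by lra; field; lra. }
  assert (hrx : r ^ 2 * x = a ^ 2) by (rewrite hr2; unfold x; field; repeat split; nra).
  assert (e : forall t, 0 < t < PI / 2 -> r * (2 * Rad x t - (1 - x) / Rad x t) =
    (2 * a ^ 2 * sin t ^ 2 + s) / sqrt (a ^ 2 * sin t ^ 2 + s)).
  { intros t ht; rewrite sqrt_scaled_Rad by lra; fold x r.
    pose proof (Rad_pos_inner x t ltac:(lra) ht) as hp; pose proof (Rad_sqr x t ltac:(lra)) as hR.
    apply Rmult_eq_reg_r with (r * Rad x t); [ | apply Rgt_not_eq, Rmult_lt_0_compat; lra].
    transitivity (2 * r ^ 2 * Rad x t ^ 2 - (r ^ 2 - r ^ 2 * x)); [field; lra | ].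
    transitivity (2 * a ^ 2 * sin t ^ 2 + s); [ | field; lra].
    rewrite hR, sin_cos_sqr.
    transitivity (2 * r ^ 2 - 2 * (r ^ 2 * x) * cos t ^ 2 - (r ^ 2 - r ^ 2 * x)); [ring | ].
    rewrite hrx, hr2; ring. }
  assert (hi := integrable_scal _ r (ell_integrable x ltac:(lra))).
  unfold psi2; fold a; rewrite RInt_integ by (apply (integrable_ext _ _ e hi)).
  rewrite <- (integ_ext _ _ e), integ_scal by (apply ell_integrable; lra).
  change (integ (fun t => 2 * Rad x t - (1 - x) / Rad x t)) with (ell x).
  rewrite gap_fun_scaled by lra; unfold gfun; fold x.
  replace (a * (sqrt (1 + s / a ^ 2) * ell x)) with (r * ell x) by (unfold r; ring).
  replace (a ^ 2 * (1 + s / a ^ 2)) with (a ^ 2 + s) by (field; lra); ring.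
Qed.

Lemma Cmod_psi1 (al : Cpx) (s : R) : 0 < Cmod al -> 0 <= s ->
  Cmod (psi1 al s) = phi (s / Cmod al ^ 2).
Proof.
  intros ha hs; unfold psi1; destruct (Req_EM_T (Cmod al) 0) as [e | hn]; [lra | ].
  rewrite I1_phi by auto; set (F := phi _).
  assert (hF : 0 < F) by (apply phi_bounds, Rdiv_le_0_compat; [lra | apply pow_lt; lra]).
  assert (e : Cmod al ^ 2 = fst al ^ 2 + snd al ^ 2).
  { apply pow2_sqrt; pose proof (pow2_ge_0 (fst al)); pose proof (pow2_ge_0 (snd al)); lra. }
  unfold Cmod at 1; simpl fst; simpl snd.
  rewrite <- (sqrt_pow2 F) by lra; f_equal; rewrite sqrt_pow2 by lra.
  transitivity (F ^ 2 * ((fst al ^ 2 + snd al ^ 2) / Cmod al ^ 2)); [field; auto | ].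
  rewrite <- e; field; auto.
Qed.

Lemma SE_orbit (d w : R) (al : Cpx) (s0 : R) : 0 < d -> 0 <= w -> 0 < Cmod al -> 0 <= s0 ->
  orbit (4 / d) w (fun n => Cmod (fst (SE d w al s0 n))) (fun n => snd (SE d w al s0 n)).
Proof.
  intros hd hw hal hs0.
  assert (pos : forall n, 0 < Cmod (fst (SE d w al s0 n)) /\ 0 <= snd (SE d w al s0 n)).
  { induction n as [ | n [h1 h2]]; [auto | ].
    assert (0 < Cmod (fst (SE d w al s0 n)) ^ 2) by (apply pow_lt; lra).
    simpl; rewrite Cmod_psi1, psi2_gap by auto.
    split; [apply phi_bounds, Rdiv_le_0_compat; lra | ].
    pose proof (gap_fun_nonneg (Cmod (fst (SE d w al s0 n)) ^ 2) _ ltac:(lra) h2).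
    assert (0 < 4 / d) by (apply Rdiv_lt_0_compat; lra).
    apply Rplus_le_le_0_compat; [apply Rmult_le_pos | ]; lra. }
  split; intros n; destruct (pos n); simpl; [apply Cmod_psi1 | apply psi2_gap]; auto.
Qed.

Lemma mse_limit (delta : R) (al : Cpx) (s0 : R) :
  delta > 64 / PI ^ 2 - 4 -> 0 < Cmod al <= 1 -> 0 <= s0 < 1 ->
  exists eps, 0 < eps /\ forall w, 0 < w < eps -> exists L,
    Un_cv (mse_seq delta w al s0) L /\
    Rabs (L / w - 4 / (1 - 2 / delta)) <= 10 ^ 6 * sqrt w.
Proof.
  intros hdelta hal hs0; pose proof mcrit_bounds as hm; pose proof PI_lower.
  assert (hdm : 4 * (1 - mcrit) < delta * mcrit).
  { replace (64 / PI ^ 2) with (4 / mcrit) in hdelta by (unfold mcrit; field; lra).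
    assert (h : 4 / mcrit < delta + 4) by lra; apply Rlt_div_l in h; lra. }
  assert (hd : 0 < delta) by nra.
  set (c0 := mcrit / (1 - mcrit)); assert (hc0 : 0 < c0) by (apply Rdiv_lt_0_compat; lra).
  set (c := 4 / delta); assert (hc : 0 < c) by (apply Rdiv_lt_0_compat; lra).
  assert (hcc : c < c0).
  { unfold c, c0; apply (Rlt_div_l 4 (mcrit / (1 - mcrit)) delta); [lra | ].
    replace (mcrit / (1 - mcrit) * delta) with (delta * mcrit / (1 - mcrit)) by (field; lra).
    apply (Rlt_div_r 4); lra. }
  assert (hc1 : c <= 162 / 100).
  { apply Rle_trans with c0; [lra | ]; unfold c0; apply (Rle_div_l mcrit); lra. }
  set (th := sqrt (c / c0)).
  assert (hth2 : th ^ 2 = c / c0) by (apply pow2_sqrt; left; apply Rdiv_lt_0_compat; lra).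
  assert (hth0 : 0 < th) by (apply sqrt_lt_R0, Rdiv_lt_0_compat; lra).
  assert (hth1 : th < 1).
  { assert (c / c0 < 1) by (apply (Rlt_div_l c); lra); nra. }
  assert (hth : 0 < th < 1) by lra.
  assert (hcth : c = th ^ 2 * (mcrit / (1 - mcrit))) by (rewrite hth2; fold c0; field; lra).
  set (b := barrier small_radius).
  assert (hsr : 0 < small_radius) by (unfold small_radius; lra).
  assert (hb : 0 < b).
  { pose proof (phi_bounds small_radius ltac:(lra)); apply Rmult_lt_0_compat; [ | apply pow_lt]; lra. }
  (* [4 * k] is [(1 + th) / 2 - th]. The three terms of the minimum below serve the entry under
     [mcrit], the descent to [small_radius] and the local contraction. *)
  set (k := (1 - th) / 8).
  exists (Rmin (k * mcrit) (Rmin (k * b) ((1 / 10 ^ 11) ^ 2))).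
  assert (hk : 0 < k) by (unfold k; lra).
  split.
  { repeat apply Rmin_pos; try apply Rmult_lt_0_compat; lra. }
  intros w [hw0 hw].
  pose proof (Rmin_l (k * mcrit) (Rmin (k * b) ((1 / 10 ^ 11) ^ 2))) as m1.
  pose proof (Rmin_r (k * mcrit) (Rmin (k * b) ((1 / 10 ^ 11) ^ 2))) as m2.
  pose proof (Rmin_l (k * b) ((1 / 10 ^ 11) ^ 2)) as m3.
  pose proof (Rmin_r (k * b) ((1 / 10 ^ 11) ^ 2)) as m4.
  pose proof (SE_orbit delta w al s0 hd ltac:(lra) (proj1 hal) (proj1 hs0)) as horb.
  fold c in horb.
  set (a := fun n => Cmod (fst (SE delta w al s0 n))) in *.
  set (s := fun n => snd (SE delta w al s0 n)) in *.
  assert (horb' := horb); rewrite hcth in horb'.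
  assert (hw1 : 4 * w <= ((1 + th) / 2 - th) * mcrit) by (unfold k in *; lra).
  assert (hw2 : 4 * w <= ((1 + th) / 2 - th) * b) by (unfold k in *; lra).
  destruct (orbit_reaches th w a s hth hw0 horb' hal hs0 hw1 small_radius hsr hw2) as [n [h0 h1]].
  destruct (local_mse c w (fun j => a (j + n)%nat) (fun j => s (j + n)%nat)) as [L [hL1 hL2]]; auto.
  - lra.
  - destruct horb as [ea es]; split; intros j; [apply ea | apply es].
  - intros j; apply (orbit_bounds th w a s hth hw0 horb' hal hs0).
  - intros j; apply (orbit_s_lower th w a s hth hw0 horb' hal hs0).
  - exists L; split.
    + apply is_lim_seq_Reals, (is_lim_seq_incr_n _ n), is_lim_seq_Reals; exact hL1.
    + replace (2 / delta) with (c / 2) by (unfold c; field; lra); exact hL2.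
Qed.

Theorem mainTheorem3 (delta : R) (alpha0 : Cpx) (s0 : R)
  (Hdelta : delta > 64 / PI ^ 2 - 4)
  (Ha0 : 0 < Cmod alpha0 <= 1)
  (Hs0 : 0 <= s0 < 1) :
  exists eps : R, eps > 0 /\
    (forall sw2 : R, 0 < sw2 < eps ->
       exists L : R, Un_cv (mse_seq delta sw2 alpha0 s0) L) /\
    (forall eta : R, eta > 0 -> exists rho : R, rho > 0 /\
       forall sw2 L : R, 0 < sw2 < rho ->
         Un_cv (mse_seq delta sw2 alpha0 s0) L ->
         Rabs (L / sw2 - 4 / (1 - 2 / delta)) < eta).
Proof.
  destruct (mse_limit delta alpha0 s0 Hdelta Ha0 Hs0) as [eps [heps hlim]].
  exists eps; split; [exact heps | split].
  - intros w hw; destruct (hlim w hw) as [L [hL _]]; exists L; exact hL.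
  - intros eta heta; set (e := eta / (2 * 10 ^ 6)).
    assert (he : 0 < e) by (apply Rdiv_lt_0_compat; lra).
    exists (Rmin eps (e ^ 2)); split; [apply Rmin_pos; [lra | apply pow_lt, he] | ].
    intros w L [hw0 hw] hL.
    pose proof (Rmin_l eps (e ^ 2)); pose proof (Rmin_r eps (e ^ 2)).
    destruct (hlim w ltac:(lra)) as [L' [hL' hb]].
    rewrite (UL_sequence _ _ _ hL hL').
    eapply Rle_lt_trans; [exact hb | ].
    assert (sqrt w <= e).
    { apply Rle_trans with (sqrt (e ^ 2)); [apply sqrt_le_1_alt; lra | right; apply sqrt_pow2; lra]. }
    apply Rle_lt_trans with (10 ^ 6 * e); [apply Rmult_le_compat_l; lra | unfold e].
    replace (10 ^ 6 * (eta / (2 * 10 ^ 6))) with (eta / 2) by field; lra.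
Qed.
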